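(* The function $\Phi : Sp_{2g}(k) \rightarrow W(k)/I^2$ that associates to $x \in Sp_{2g}(k)$ the element $f_{00}(\tilde x) \bmod I^2$, where $\tilde x\in\mathcal{S}_L*\mathcal{S}_{L^*}$ is any lift of $x$ (the result being independent of the lift), is the unique function $\Phi:Sp_{2g}(k)\to W(k)/I^2$ that satisfies $$\forall x,y \in Sp_{2g}(k) \quad \Phi(xy) - \Phi(x) - \Phi(y) = \mu(x,y) \bmod I^2 .$$
   Context: $k$ is a field of characteristic different from $2$, $g\ge1$, $L=k^g$, $H(L)=L\oplus L^*$ with symplectic form $\omega((x,\xi),(y,\eta))=\xi(y)-\eta(x)$ and isometry group $Sp_{2g}(k)$. $W(k)$ is the Witt ring of symmetric bilinear forms over $k$, $I=\ker(W(k)\to\mathbb{Z}/2)$ (rank mod 2) its fundamental ideal; the class in $W(k)$ of a possibly degenerate form $(P,q)$ is the class of the induced form on $P/\ker q$. Write $L_j=L$ for $j$ even and $L_j=L^*$ for $j$ odd (with $L^{**}=L$). For a symmetric map $q:L\to L^*$ put $E(q)=\begin{pmatrix}1&0\\ q&1\end{pmatrix}$, and for a symmetric map $q:L^*\to L$ put $E(q)=\begin{pmatrix}1&q\\ 0&1\end{pmatrix}$ (blocks for $L\oplus L^*$). The former matrices form the group $\mathcal{S}_{L^*}$, the pointwise stabilizer of $L^*$ in $Sp_{2g}(k)$; the latter form $\mathcal{S}_L$, the pointwise stabilizer of $L$. Let $E:\mathcal{S}_L*\mathcal{S}_{L^*}\to Sp_{2g}(k)$ be the evaluation homomorphism from the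 free product; it is surjective. A lift of $x$ is an element $\tilde x$ with $E(\tilde x)=x$. A Sturm sequence is a sequence $(q_m,\dots,q_n)$ of symmetric maps $q_j:L_j\to L_{j+1}$ (zero allowed); it represents the product $q_m\cdots q_n$ in $\mathcal{S}_L*\mathcal{S}_{L^*}$ (with $q_j$ in $\mathcal{S}_{L^*}$ for $j$ even, in $\mathcal{S}_L$ for $j$ odd). It is of type $00$ if $m$ and $n$ are even. Its Sylvester matrix is the symmetric bilinear form with support $L_m\oplus\dots\oplus L_n$ given by the block tridiagonal matrix with diagonal blocks $(-1)^jq_j$ and all blocks immediately above and below the diagonal equal to the identity. Every $w\in\mathcal{S}_L*\mathcal{S}_{L^*}$ is represented by a Sturm sequence of type $00$ (adding zero letters at the ends if necessary), and $f_{00}(w)\in W(k)$ is the class of the Sylvester matrix of any such representative (it is independent of the representative). The function $\mu:Sp_{2g}(k)\times Sp_{2g}(k)\to W(k)$ is $\mu(x,y)=f_{00}(\tilde x\tilde y)-f_{00}(\tilde x)-f_{00}(\tilde y)$ for any lifts $\tilde x,\tilde y$ of $x,y$; it is independent of the lifts. (If $\tilde x,\tilde y$ are given by type $00$ Sturm sequences, a type $00$ sequence for $\tilde x\tilde y$ is obtained by inserting the zero map $L^*\to L$ between them.) *)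

(* Defs.v *)
From HB Require Import structures.
From mathcomp Require Import all_boot all_order all_algebra.
From mathcomp Require Import boolp classical_sets.
From mathcomp.real_closed Require Import mxtens.
Set Implicit Arguments.
Unset Strict Implicit.
Unset Printing Implicit Defensive.
Import GRing.Theory.
Local Open Scope ring_scope.
Local Open Scope quotient_scope.

Section Isometry.
Variable k : fieldType.

(* A matrix A : 'M_n stands for the bilinear form (u, v) |-> u^T A v on
   column vectors. *)
Definition isometric m n (A : 'M[k]_m) (B : 'M[k]_n) : Prop :=
  exists (P : 'M[k]_(m, n)) (Q : 'M[k]_(n, m)),
    [/\ P *m Q = 1%:M, Q *m P = 1%:M & P^T *m A *m P = B].

(* The columns of P span a totally isotropic subspace of half dimension. *)
Definition metabolic n (A : 'M[k]_n) : Prop :=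
  exists m (P : 'M[k]_(n, m)),
    [/\ n = (m + m)%N, \rank P = m & P^T *m A *m P = 0].

Definition osum m n (A : 'M[k]_m) (B : 'M[k]_n) : 'M[k]_(m + n) :=
  block_mx A 0 0 B.

Lemma iso_refl n (A : 'M_n) : isometric A A.
Proof. by exists 1%:M, 1%:M; rewrite trmx1 !mul1mx !mulmx1. Qed.

Lemma iso_sym m n (A : 'M_m) (B : 'M_n) : isometric A B -> isometric B A.
Proof.
case=> P [Q [PQ QP <-]]; exists Q, P; split=> //.
rewrite !mulmxA -trmx_mul PQ trmx1 mul1mx -mulmxA PQ mulmx1 //.
Qed.

Lemma iso_trans m n p (A : 'M_m) (B : 'M_n) (C : 'M_p) :
  isometric A B -> isometric B C -> isometric A C.
Proof.
case=> P [Q [PQ QP <-]] [P' [Q' [PQ' QP' <-]]].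
exists (P *m P'), (Q' *m Q); split; last by rewrite trmx_mul !mulmxA.
  by rewrite mulmxA -(mulmxA P) PQ' mulmx1.
by rewrite mulmxA -(mulmxA Q') QP mulmx1.
Qed.

Lemma iso_reindex m n (A : 'M_m) (B : 'M_n) (f : 'I_m -> 'I_n) :
  bijective f -> (forall i j, B (f i) (f j) = A i j) -> isometric A B.
Proof.
case=> h fK hK AB; apply: iso_sym.
exists (\matrix_(i, j) (i == f j)%:R), (\matrix_(j, i) (i == f j)%:R); split.
- apply/matrixP => i j; rewrite !mxE (bigD1 (h i)) //= !mxE hK eqxx mul1r.
  rewrite big1 ?addr0; first by rewrite eq_sym.
  move=> a; rewrite !mxE => ah; case: eqP => [E|_]; last by rewrite mul0r.
  by rewrite E fK eqxx in ah.
- apply/matrixP => i j; rewrite !mxE (bigD1 (f i)) //= !mxE eqxx mul1r.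
  rewrite big1 ?addr0; first by rewrite (can_eq fK).
  move=> a; rewrite !mxE => ah; case: eqP => [E|_]; last by rewrite mul0r.
  by rewrite E eqxx in ah.
apply/matrixP => i j; rewrite -AB mxE (bigD1 (f j)) //= [X in _ * X]mxE.
rewrite eqxx mulr1 [X in _ + X]big1 ?addr0 => [|a ah]; last first.
  by rewrite [X in _ * X]mxE (negPf ah) mulr0.
rewrite mxE (bigD1 (f i)) //= !mxE eqxx mul1r big1 ?addr0 // => a ah.
by rewrite !mxE (negPf ah) mul0r.
Qed.

Lemma iso_osum m n m' n' (A : 'M_m) (B : 'M_n) (A' : 'M_m') (B' : 'M_n') :
  isometric A A' -> isometric B B' -> isometric (osum A B) (osum A' B').
Proof.
case=> P [Q [PQ QP <-]] [P' [Q' [PQ' QP' <-]]].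
exists (block_mx P 0 0 P'), (block_mx Q 0 0 Q'); split.
- by rewrite mulmx_block !(mul0mx, mulmx0, addr0, add0r) PQ PQ' scalar_mx_block.
- by rewrite mulmx_block !(mul0mx, mulmx0, addr0, add0r) QP QP' scalar_mx_block.
by rewrite tr_block_mx /osum !mulmx_block !(mul0mx, mulmx0, addr0, add0r, trmx0).
Qed.

Lemma iso_osumC m n (A : 'M_m) (B : 'M_n) :
  isometric (osum A B) (osum B A).
Proof.
pose f a b (i : 'I_(a + b)) : 'I_(b + a) :=
  match split i with inl i => rshift b i | inr i => lshift a i end.
have fE a b i : f a b i =
  match split i with inl i => rshift b i | inr i => lshift a i end by [].
have fK a b : cancel (f a b) (f b a).
  move=> i; rewrite -[i]splitK; case: (split i) => j; rewrite !fE unsplitK /=.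
    by rewrite (unsplitK (inr _ : 'I_b + 'I_a)).
  by rewrite (unsplitK (inl _ : 'I_b + 'I_a)).
apply: (iso_reindex (f := f m n)); first by exists (f n m); apply: fK.
move=> i j; rewrite -[i]splitK -[j]splitK.
by case: (split i) => i'; case: (split j) => j'; rewrite !fE !unsplitK /=;
   rewrite /osum ?(block_mxEul, block_mxEur, block_mxEdl, block_mxEdr) ?mxE.
Qed.

Lemma iso_cast m n (e : (m = n) * (m = n)) (A : 'M_m) :
  isometric (castmx e A) A.
Proof.
case: e => e e'; rewrite (eq_irrelevance e' e) {e'}.
by case: n / e; rewrite castmx_id; apply: iso_refl.
Qed.

Lemma iso_osumA m n p (A : 'M_m) (B : 'M_n) (C : 'M_p) :
  isometric (osum A (osum B C)) (osum (osum A B) C).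
Proof.
rewrite /osum -[X in block_mx A X _ _]row_mx0 -[X in block_mx A _ X _]col_mx0.
by rewrite block_mxA row_mx0 col_mx0; apply: iso_cast.
Qed.

Lemma iso_osum0 m (A : 'M_m) (O : 'M_0) : isometric (osum O A) A.
Proof.
apply: iso_sym.
apply: (iso_reindex (f := @rshift 0 m)); last by move=> i j; rewrite /osum block_mxEdr.
exists (fun i : 'I_(0 + m) => i) => [i|i]; exact: val_inj.
Qed.

Lemma iso_osumCA m n p (A : 'M_m) (B : 'M_n) (C : 'M_p) :
  isometric (osum A (osum B C)) (osum B (osum A C)).
Proof.
apply: iso_trans (iso_osumA _ _ _) _.
apply: iso_trans (iso_osum (iso_osumC _ _) (iso_refl _)) _.
exact/iso_sym/iso_osumA.
Qed.

Lemma iso_osumAC m n p (A : 'M_m) (B : 'M_n) (C : 'M_p) :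
  isometric (osum (osum A B) C) (osum (osum A C) B).
Proof.
apply: iso_trans (iso_sym (iso_osumA _ _ _)) _.
apply: iso_trans (iso_osum (iso_refl _) (iso_osumC _ _)) _.
exact: iso_osumA.
Qed.

Lemma iso_osumACA m n p q (A : 'M_m) (B : 'M_n) (C : 'M_p) (D : 'M_q) :
  isometric (osum (osum A B) (osum C D)) (osum (osum A C) (osum B D)).
Proof.
apply: iso_trans (iso_osumA _ _ _) _.
apply: iso_trans (iso_osum (iso_osumAC _ _ _) (iso_refl _)) _.
exact/iso_sym/iso_osumA.
Qed.

Lemma iso_opp m n (A : 'M_m) (B : 'M_n) : isometric A B -> isometric (- A) (- B).
Proof.
by case=> P [Q [PQ QP <-]]; exists P, Q; split=> //; rewrite mulmxN mulNmx.
Qed.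

Lemma iso_dim m n (A : 'M_m) (B : 'M_n) : isometric A B -> m = n.
Proof.
case=> P [Q [PQ QP _]]; apply/eqP; rewrite eqn_leq.
move: (mulmx_max_rank P Q) (mulmx_max_rank Q P).
by rewrite PQ QP !mxrank1 => -> ->.
Qed.

Lemma tens1 m n : (1%:M *t 1%:M : 'M[k]_(m * n)) = 1%:M.
Proof.
apply/matrixP => i j; case: (mxtens_indexP i) => a b.
case: (mxtens_indexP j) => c d; rewrite tensmxE !mxE -natrM mulnb.
by rewrite (can_eq (@mxtens_indexK m n)) xpair_eqE.
Qed.

Lemma iso_tens m n m' n' (A : 'M_m) (B : 'M_n) (A' : 'M_m') (B' : 'M_n') :
  isometric A A' -> isometric B B' -> isometric (A *t B) (A' *t B').
Proof.
case=> P [Q [PQ QP <-]] [P' [Q' [PQ' QP' <-]]].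
exists (P *t P'), (Q *t Q'); split.
- by rewrite tensmx_mul PQ PQ' tens1.
- by rewrite tensmx_mul QP QP' tens1.
by rewrite trmx_tens !tensmx_mul.
Qed.

Lemma iso_tensC m n (A : 'M_m) (B : 'M_n) : isometric (A *t B) (B *t A).
Proof.
pose f a b (i : 'I_(a * b)) : 'I_(b * a) :=
  mxtens_index ((mxtens_unindex i).2, (mxtens_unindex i).1).
have fE a b i j : f a b (mxtens_index (i, j)) = mxtens_index (j, i).
  by rewrite /f mxtens_indexK.
have fK a b : cancel (f a b) (f b a).
  by move=> i; case: (mxtens_indexP i) => x y; rewrite !fE.
apply: (iso_reindex (f := f m n)); first by exists (f n m); apply: fK.
move=> i j; case: (mxtens_indexP i) => a b; case: (mxtens_indexP j) => c d.
by rewrite !fE !tensmxE mulrC.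
Qed.

Lemma iso_tensA m n p (A : 'M_m) (B : 'M_n) (C : 'M_p) :
  isometric (A *t (B *t C)) (A *t B *t C).
Proof.
pose f (i : 'I_(m * (n * p))) : 'I_(m * n * p) :=
  let x := mxtens_unindex i in let y := mxtens_unindex x.2 in
  mxtens_index (mxtens_index (x.1, y.1), y.2).
pose h (i : 'I_(m * n * p)) : 'I_(m * (n * p)) :=
  let x := mxtens_unindex i in let y := mxtens_unindex x.1 in
  mxtens_index (y.1, mxtens_index (y.2, x.2)).
have fE a b c : f (mxtens_index (a, mxtens_index (b, c))) =
    mxtens_index (mxtens_index (a, b), c).
  by rewrite /f; cbv zeta; rewrite !mxtens_indexK.
have hE a b c : h (mxtens_index (mxtens_index (a, b), c)) =
    mxtens_index (a, mxtens_index (b, c)).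
  by rewrite /h; cbv zeta; rewrite !mxtens_indexK.
apply: (iso_reindex (f := f)).
  exists h => i.
    case: (mxtens_indexP i) => a bc; case: (mxtens_indexP bc) => b c.
    by rewrite fE hE.
  case: (mxtens_indexP i) => ab c; case: (mxtens_indexP ab) => a b.
  by rewrite hE fE.
move=> i j.
case: (mxtens_indexP i) => a bc; case: (mxtens_indexP bc) => b c.
case: (mxtens_indexP j) => a' bc'; case: (mxtens_indexP bc') => b' c'.
by rewrite !fE !tensmxE mulrA.
Qed.

Lemma iso_tens1 m (A : 'M_m) : isometric ((1%:M : 'M_1) *t A) A.
Proof.
pose f (i : 'I_(1 * m)) : 'I_m := (mxtens_unindex i).2.
apply: (iso_reindex (f := f)).
  exists (fun i => mxtens_index (ord0, i)) => i; last by rewrite /f mxtens_indexK.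
  by case: (mxtens_indexP i) => a b; rewrite /f mxtens_indexK [a]ord1.
move=> i j; case: (mxtens_indexP i) => a b; case: (mxtens_indexP j) => c d.
by rewrite tensmxE /f !mxtens_indexK [a]ord1 [c]ord1 mxE eqxx mul1r.
Qed.

Lemma iso_tensD m n p (A : 'M_m) (B : 'M_n) (C : 'M_p) :
  isometric (osum A B *t C) (osum (A *t C) (B *t C)).
Proof.
pose f (i : 'I_((m + n) * p)) : 'I_(m * p + n * p) :=
  let x := mxtens_unindex i in
  match split x.1 with
  | inl a => lshift (n * p) (mxtens_index (a, x.2))
  | inr b => rshift (m * p) (mxtens_index (b, x.2))
  end.
pose h (i : 'I_(m * p + n * p)) : 'I_((m + n) * p) :=
  match split i with
  | inl a => let x := mxtens_unindex a in mxtens_index (lshift n x.1, x.2)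
  | inr b => let x := mxtens_unindex b in mxtens_index (rshift m x.1, x.2)
  end.
have fl a c : f (mxtens_index (lshift n a, c)) = lshift _ (mxtens_index (a, c)).
  by rewrite /f mxtens_indexK /= (unsplitK (inl a)).
have fr b c : f (mxtens_index (rshift m b, c)) = rshift _ (mxtens_index (b, c)).
  by rewrite /f mxtens_indexK /= (unsplitK (inr b)).
have hl a c : h (lshift _ (mxtens_index (a, c))) = mxtens_index (lshift n a, c).
  by rewrite /h (unsplitK (inl _)) mxtens_indexK.
have hr a c : h (rshift _ (mxtens_index (a, c))) = mxtens_index (rshift m a, c).
  by rewrite /h (unsplitK (inr _)) mxtens_indexK.
apply: (iso_reindex (f := f)).
  exists h => i.
    case: (mxtens_indexP i) => x c; rewrite -[x]splitK.
    by case: (split x) => a /=; rewrite ?fl ?hl ?fr ?hr.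
  rewrite -[i]splitK; case: (split i) => x /=; case: (mxtens_indexP x) => a b.
    by rewrite hl fl.
  by rewrite hr fr.
move=> i j; case: (mxtens_indexP i) => x c; case: (mxtens_indexP j) => y d.
rewrite -[x]splitK -[y]splitK.
case: (split x) => a; case: (split y) => b /=;
  rewrite ?fl ?fr tensmxE /osum
    ?(block_mxEul, block_mxEur, block_mxEdl, block_mxEdr) ?tensmxE //;
  by rewrite !mxE mul0r.
Qed.

Lemma metabolic0 (O : 'M_0) : metabolic O.
Proof. by exists 0%N, 0; rewrite mxrank0 mulmx0. Qed.

Lemma metabolic_osum m n (A : 'M_m) (B : 'M_n) :
  metabolic A -> metabolic B -> metabolic (osum A B).
Proof.
case=> a [P [mE rP PA]] [b [Q [nE rQ QB]]].
exists (a + b)%N, (block_mx P 0 0 Q); split.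
- by rewrite mE nE addnACA.
- by rewrite rank_diag_block_mx rP rQ.
rewrite tr_block_mx /osum !mulmx_block !(mul0mx, mulmx0, addr0, add0r, trmx0).
by rewrite PA QB block_mx0.
Qed.

Lemma metabolic_tens m n (A : 'M_m) (B : 'M_n) :
  metabolic A -> metabolic (A *t B).
Proof.
case=> a [P [mE rP PA]]; exists (a * n)%N, (P *t 1%:M); split.
- by rewrite mE mulnDl.
- have := mulmxVp; have rfP : row_free P^T by rewrite /row_free mxrank_tr rP.
  have PP := mulmxVp rfP.
  have E : (P *t (1%:M : 'M[k]_n))^T *m (pinvmx P^T *t 1%:M) = 1%:M.
    by rewrite trmx_tens tensmx_mul trmx1 mulmx1 PP tens1.
  move=> _; apply/eqP; rewrite eqn_leq rank_leq_col /= -mxrank_tr.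
  have := mxrankM_maxl (P *t (1%:M : 'M[k]_n))^T (pinvmx P^T *t 1%:M).
  by rewrite E mxrank1.
by rewrite trmx_tens !tensmx_mul PA tens0mx.
Qed.

Lemma metabolic_opp n (A : 'M_n) : metabolic A -> metabolic (- A).
Proof.
case=> a [P [mE rP PA]]; exists a, P; split=> //.
by rewrite mulmxN mulNmx PA oppr0.
Qed.

Lemma metabolicN n (A : 'M_n) : metabolic (osum A (- A)).
Proof.
exists n, (col_mx 1%:M 1%:M); split=> //.
  apply/eqP; rewrite eqn_leq rank_leq_col /=.
  have := mxrankM_maxr (row_mx (1%:M : 'M[k]_n) (0 : 'M[k]_n)) (col_mx 1%:M (1%:M : 'M[k]_n)).
  by rewrite mul_row_col mul0mx addr0 mulmx1 mxrank1.
rewrite tr_col_mx /osum mul_row_block trmx1 !(mul1mx, mulmx0, addr0, add0r).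
by rewrite mul_row_col !mulmx1 subrr.
Qed.

End Isometry.

Section WittRing.
Variable k : fieldType.

(* Non-degenerate symmetric bilinear spaces over k (the zero space included). *)
Record ispace := ISpace {
  gram_of : {n : nat & 'M[k]_n};
  _ : `[< (tagged gram_of)^T = tagged gram_of /\ tagged gram_of \in unitmx >]
}.
HB.instance Definition _ := [isSub for gram_of].
HB.instance Definition _ := [Choice of ispace by <:].

Definition idim (x : ispace) : nat := tag (gram_of x).
Definition gram (x : ispace) : 'M[k]_(idim x) := tagged (gram_of x).

Definition mk_ispace n (A : 'M[k]_n) (h : A^T = A /\ A \in unitmx) : ispace :=
  @ISpace (Tagged (fun n => 'M[k]_n) A) (asboolT h).

Lemma ispaceP (x : ispace) : (gram x)^T = gram x /\ gram x \in unitmx.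
Proof. by case: x => A h; apply/asboolP. Qed.

Lemma ispace0_proof : (0 : 'M[k]_0)^T = 0 /\ (0 : 'M[k]_0) \in unitmx.
Proof. by rewrite trmx0 unitmxE det_mx00 unitr1. Qed.

Lemma ispace1_proof : (1%:M : 'M[k]_1)^T = 1%:M /\ (1%:M : 'M[k]_1) \in unitmx.
Proof. by rewrite trmx1 unitmx1. Qed.

Lemma iopp_proof (x : ispace) : (- gram x)^T = - gram x /\ - gram x \in unitmx.
Proof.
have [xT xU] := ispaceP x; split; first by rewrite linearN /= xT.
by rewrite -scaleN1r unitmxZ ?unitrN1.
Qed.

Lemma iadd_proof (x y : ispace) :
  (osum (gram x) (gram y))^T = osum (gram x) (gram y) /\
  osum (gram x) (gram y) \in unitmx.
Proof.
have [[xT xU] [yT yU]] := (ispaceP x, ispaceP y); split.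
  by rewrite tr_block_mx !trmx0 xT yT.
by rewrite unitmxE det_ublock unitrM -!unitmxE xU.
Qed.

Lemma imul_proof (x y : ispace) :
  (gram x *t gram y)^T = gram x *t gram y /\ gram x *t gram y \in unitmx.
Proof.
have [[xT xU] [yT yU]] := (ispaceP x, ispaceP y); split.
  by rewrite trmx_tens xT yT.
have : (gram x *t gram y) *m (invmx (gram x) *t invmx (gram y)) = 1%:M.
  by rewrite tensmx_mul !mulmxV ?tens1.
by case/mulmx1_unit.
Qed.

Definition ispace0 := mk_ispace ispace0_proof.
Definition ispace1 := mk_ispace ispace1_proof.
Definition iopp (x : ispace) := mk_ispace (iopp_proof x).
Definition iadd (x y : ispace) := mk_ispace (iadd_proof x y).
Definition imul (x y : ispace) := mk_ispace (imul_proof x y).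

(* In characteristic different from 2, the metabolic spaces are exactly the
   hyperbolic ones; using them makes W(k) a ring for every field k. *)
Definition witt_equiv (x y : ispace) : bool :=
  `[< exists M N : ispace, [/\ metabolic (gram M), metabolic (gram N) &
       isometric (gram (iadd x M)) (gram (iadd y N))] >].

Lemma witt_equivP x y : reflect
  (exists M N : ispace, [/\ metabolic (gram M), metabolic (gram N) &
     isometric (osum (gram x) (gram M)) (osum (gram y) (gram N))])
  (witt_equiv x y).
Proof. exact: asboolP. Qed.

Lemma iso_witt x y : isometric (gram x) (gram y) -> witt_equiv x y.
Proof.
move=> xy; apply/witt_equivP; exists ispace0, ispace0.
by split; try exact: metabolic0; apply: iso_osum => //; apply: iso_refl.
Qed.

Lemma witt_refl : reflexive witt_equiv.
Proof. by move=> x; apply/iso_witt/iso_refl. Qed.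

Lemma witt_sym : symmetric witt_equiv.
Proof.
by move=> x y; apply/witt_equivP/witt_equivP => -[M [N [mM mN /iso_sym h]]];
  exists N, M.
Qed.

Lemma witt_trans : transitive witt_equiv.
Proof.
move=> y x z /witt_equivP[M [N [mM mN h]]] /witt_equivP[M' [N' [mM' mN' h']]].
apply/witt_equivP; exists (iadd M M'), (iadd N' N).
split; try exact: metabolic_osum.
apply: iso_trans (iso_osumA _ _ _) _.
apply: iso_trans (iso_osum h (iso_refl _)) _.
apply: iso_trans (iso_osumAC _ _ _) _.
apply: iso_trans (iso_osum h' (iso_refl _)) _.
exact/iso_sym/iso_osumA.
Qed.

Canonical witt_equiv_rel := EquivRel witt_equiv witt_refl witt_sym witt_trans.

Definition witt := {eq_quot witt_equiv}.
HB.instance Definition _ : EqQuotient ispace witt_equiv witt := EqQuotient.on witt.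
HB.instance Definition _ := Choice.on witt.

Lemma witt_eq x y : witt_equiv x y -> \pi_witt x = \pi_witt y.
Proof. by move=> h; apply/eqP; rewrite piE. Qed.

Lemma witt_repr (x : ispace) : witt_equiv (repr (\pi_witt x)) x.
Proof. by have /eqP := reprK (\pi_witt x); rewrite piE. Qed.

Lemma witt_add2 x x' y y' :
  witt_equiv x x' -> witt_equiv y y' -> witt_equiv (iadd x y) (iadd x' y').
Proof.
move=> /witt_equivP[M [N [mM mN h]]] /witt_equivP[M' [N' [mM' mN' h']]].
apply/witt_equivP; exists (iadd M M'), (iadd N N').
split; try exact: metabolic_osum.
apply: iso_trans (iso_osumACA _ _ _ _) _.
apply: iso_trans (iso_osum h h') _.
exact: iso_osumACA.
Qed.

Lemma witt_opp2 x x' : witt_equiv x x' -> witt_equiv (iopp x) (iopp x').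
Proof.
move=> /witt_equivP[M [N [mM mN h]]].
apply/witt_equivP; exists (iopp M), (iopp N); split; try exact: metabolic_opp.
by have := iso_opp h; rewrite /osum !opp_block_mx !oppr0.
Qed.

Lemma witt_mul2l x x' y :
  witt_equiv x x' -> witt_equiv (imul x y) (imul x' y).
Proof.
move=> /witt_equivP[M [N [mM mN h]]].
apply/witt_equivP; exists (imul M y), (imul N y).
split; try exact: metabolic_tens.
apply: iso_trans (iso_sym (iso_tensD _ _ _)) _.
apply: iso_trans (iso_tens h (iso_refl _)) _.
exact: iso_tensD.
Qed.

Lemma witt_mulC x y : witt_equiv (imul x y) (imul y x).
Proof. exact/iso_witt/iso_tensC. Qed.

Lemma witt_mul2 x x' y y' :
  witt_equiv x x' -> witt_equiv y y' -> witt_equiv (imul x y) (imul x' y').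
Proof.
move=> hx hy; apply: witt_trans (witt_mul2l _ hx) _.
apply: witt_trans (witt_mulC _ _) _; apply: witt_trans (witt_mul2l _ hy) _.
exact: witt_mulC.
Qed.

Lemma metabolic_witt0 x : metabolic (gram x) -> witt_equiv x ispace0.
Proof.
move=> mx; apply/witt_equivP; exists ispace0, x; split=> //.
  exact: metabolic0.
exact: iso_osumC.
Qed.

Definition witt0 : witt := lift_cst witt ispace0.
Definition witt1 : witt := lift_cst witt ispace1.
Definition wittN := lift_op1 witt iopp.
Definition wittD := lift_op2 witt iadd.
Definition wittM := lift_op2 witt imul.

Canonical pi_witt0_morph := PiConst witt0.
Canonical pi_witt1_morph := PiConst witt1.

Lemma pi_wittN : {morph \pi : x / iopp x >-> wittN x}.
Proof.
by move=> x; unlock wittN; apply/witt_eq/witt_opp2; rewrite witt_sym witt_repr.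
Qed.
Canonical pi_wittN_morph := PiMorph1 pi_wittN.

Lemma pi_wittD : {morph \pi : x y / iadd x y >-> wittD x y}.
Proof.
by move=> x y; unlock wittD; apply/witt_eq/witt_add2; rewrite witt_sym witt_repr.
Qed.
Canonical pi_wittD_morph := PiMorph2 pi_wittD.

Lemma pi_wittM : {morph \pi : x y / imul x y >-> wittM x y}.
Proof.
by move=> x y; unlock wittM; apply/witt_eq/witt_mul2; rewrite witt_sym witt_repr.
Qed.
Canonical pi_wittM_morph := PiMorph2 pi_wittM.

Lemma wittDA : associative wittD.
Proof.
elim/quotW=> x; elim/quotW=> y; elim/quotW=> z; rewrite !piE.
exact/witt_eq/iso_witt/iso_osumA.
Qed.

Lemma wittDC : commutative wittD.
Proof.
elim/quotW=> x; elim/quotW=> y; rewrite !piE.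
exact/witt_eq/iso_witt/iso_osumC.
Qed.

Lemma witt0D : left_id witt0 wittD.
Proof. by elim/quotW=> x; rewrite !piE; exact/witt_eq/iso_witt/iso_osum0. Qed.

Lemma wittND : left_inverse witt0 wittN wittD.
Proof.
elim/quotW=> x; rewrite wittDC !piE.
exact/witt_eq/metabolic_witt0/metabolicN.
Qed.

HB.instance Definition _ :=
  GRing.isZmodule.Build witt wittDA wittDC witt0D wittND.

Lemma wittMA : associative wittM.
Proof.
elim/quotW=> x; elim/quotW=> y; elim/quotW=> z; rewrite !piE.
exact/witt_eq/iso_witt/iso_tensA.
Qed.

Lemma wittMC : commutative wittM.
Proof.
elim/quotW=> x; elim/quotW=> y; rewrite !piE.
exact/witt_eq/iso_witt/iso_tensC.
Qed.

Lemma witt1M : left_id witt1 wittM.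
Proof. by elim/quotW=> x; rewrite !piE; exact/witt_eq/iso_witt/iso_tens1. Qed.

Lemma wittMD : left_distributive wittM +%R.
Proof.
elim/quotW=> x; elim/quotW=> y; elim/quotW=> z.
rewrite -[LHS]/(wittM (wittD _ _) _) -[RHS]/(wittD _ _) !piE.
exact/witt_eq/iso_witt/iso_tensD.
Qed.

Lemma witt_equiv_odd x y : witt_equiv x y -> odd (idim x) = odd (idim y).
Proof.
move=> /witt_equivP[M [N [[m [P [mE _ _]]] [n [Q [nE _ _]]]]]] /iso_dim.
move/(congr1 odd); rewrite !oddD mE nE !addnn !odd_double !addbF.
by [].
Qed.

Definition rank2 : witt -> 'F_2 :=
  lift_fun1 witt (fun x : ispace => (idim x)%:R : 'F_2).

Lemma addF2 (a : 'F_2) : a + a = 0.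
Proof. by apply/val_inj; case: a => [[|[|]]]. Qed.

Lemma natF2 n : (n%:R : 'F_2) = (odd n)%:R.
Proof.
by rewrite -[in LHS](odd_double_half n) natrD -addnn natrD addF2 addr0.
Qed.

Lemma pi_rank2 : {mono \pi : x / (idim x)%:R : 'F_2 >-> rank2 x}.
Proof.
move=> x; unlock rank2; rewrite natF2 [RHS]natF2.
by rewrite (witt_equiv_odd (witt_repr x)).
Qed.
Canonical pi_rank2_morph := PiMono1 pi_rank2.

Lemma rank2_1 : rank2 witt1 = 1.
Proof. by rewrite piE. Qed.

Lemma witt1_neq0 : witt1 != 0.
Proof.
apply/eqP => /(congr1 rank2); rewrite rank2_1 -[0]/witt0 piE.
by move/eqP.
Qed.

HB.instance Definition _ :=
  GRing.Zmodule_isComNzRing.Build witt wittMA wittMC witt1M wittMD witt1_neq0.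

Lemma rank2_is_zmod_morphism : zmod_morphism rank2.
Proof.
elim/quotW=> x; elim/quotW=> y.
rewrite -[_ - _]/(wittD _ (wittN _)) !piE natrD; congr (_ + _).
by apply/eqP; rewrite -addr_eq0 addF2.
Qed.

Lemma rank2_is_monoid_morphism : monoid_morphism rank2.
Proof.
split; first exact: rank2_1.
elim/quotW=> x; elim/quotW=> y.
by rewrite -[_ * _ in LHS]/(wittM _ _) !piE natrM.
Qed.

HB.instance Definition _ :=
  GRing.isZmodMorphism.Build witt 'F_2 rank2 rank2_is_zmod_morphism.
HB.instance Definition _ :=
  GRing.isMonoidMorphism.Build witt 'F_2 rank2 rank2_is_monoid_morphism.

(* The fundamental ideal I and its square, the ideal generated by the products
   of two elements of I. *)
Definition fundI : {pred witt} := fun a => rank2 a == 0.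

Definition fundI2 : {pred witt} := fun a =>
  `[< exists (n : nat) (b c : 'I_n -> witt),
        (forall i, b i \in fundI /\ c i \in fundI) /\
        a = \sum_(i < n) b i * c i >].

Lemma fundI2_idealr_closed : idealr_closed fundI2.
Proof.
split.
- apply/asboolP; exists 0%N, (fun=> 0), (fun=> 0).
  by split=> [[]|]; rewrite ?big_ord0.
- apply/asboolP => -[n [b [c [bc /(congr1 rank2)]]]].
  rewrite rmorph1 rmorph_sum big1 => [/eqP //|i _].
  by have [/eqP bi _] := bc i; rewrite rmorphM /= bi mul0r.
move=> a u v /asboolP[n [b [c [bc ->]]]] /asboolP[n' [b' [c' [bc' ->]]]].
apply/asboolP; exists (n + n')%N,
  (fun i => match split i with inl j => a * b j | inr j => b' j end),
  (fun i => match split i with inl j => c j | inr j => c' j end); split.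
  move=> i; case: (split i) => j //; have [bj cj] := bc j; split=> //.
  by rewrite unfold_in rmorphM /= (eqP bj) mulr0.
rewrite big_split_ord /= mulr_sumr; congr (_ + _); apply: eq_bigr => i _.
  by rewrite (unsplitK (inl i)) mulrA.
by rewrite (unsplitK (inr i)).
Qed.

HB.instance Definition _ := isIdealr.Build witt fundI2 fundI2_idealr_closed.

Definition witt_I2 := {ideal_quot fundI2}.

End WittRing.

Section WittClass.
Variable k : fieldType.

Definition symmx (n : nat) := {A : 'M[k]_n | A^T == A}.

Lemma symmxP n (A : symmx n) : (val A)^T = val A.
Proof. by case: A => A /= /eqP. Qed.

(* row_base A is a surjection k^n -> k^(\rank A) with kernel ker A, and
   Q := pinvmx (row_base A) is a section of it, so that Q^T A Q is the Gram
   matrix of the form induced by A on k^n / ker A. *)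
Definition quot_gram n (A : 'M[k]_n) : 'M[k]_(\rank A) :=
  let Q := pinvmx (row_base A) in Q^T *m A *m Q.

Lemma quot_gramE n (A : symmx n) :
  (row_base (val A))^T *m quot_gram (val A) *m row_base (val A) = val A.
Proof.
have AT := symmxP A; move: (val A) AT => {}A AT; rewrite /quot_gram.
move: (mulmx_base A) (mulmxVp (row_base_free A)).
cbv zeta; move: (pinvmx (row_base A)) => Q.
move: (row_base A) (col_base A) => P C.
move: (\rank A) Q P C => r Q P C CP PQ.
have AQP : A *m Q *m P = A by rewrite -CP -(mulmxA C) PQ mulmx1.
have PQA : P^T *m Q^T *m A = A by rewrite -{1}AT -!trmx_mul mulmxA AQP AT.
by rewrite !mulmxA PQA AQP.
Qed.

Lemma quot_gram_proof n (A : symmx n) :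
  (quot_gram (val A))^T = quot_gram (val A) /\ quot_gram (val A) \in unitmx.
Proof.
split.
  rewrite /quot_gram; cbv zeta; move: (pinvmx _) => Q.
  by rewrite !trmx_mul trmxK symmxP mulmxA.
rewrite -row_free_unit /row_free eqn_leq rank_leq_row /=.
have := mxrankM_maxr (row_base (val A))^T (quot_gram (val A)).
apply: leq_trans; apply: leq_trans (mxrankM_maxl _ (row_base (val A))).
by rewrite quot_gramE.
Qed.

Definition witt_class n (A : symmx n) : witt k :=
  \pi_(witt k) (mk_ispace (quot_gram_proof A)).

End WittClass.

Section FreeProduct.
Variables G H : groupType.

(* G * H: words in the elements of G and H, modulo removing a neutral letter
   and multiplying two adjacent letters from the same factor. *)
Definition fpword := seq (G + H).

Inductive fpstep : fpword -> fpword -> Prop :=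
| FPOneL s t : fpstep (s ++ inl 1%g :: t) (s ++ t)
| FPOneR s t : fpstep (s ++ inr 1%g :: t) (s ++ t)
| FPMulL s t a b : fpstep (s ++ inl a :: inl b :: t) (s ++ inl (a * b)%g :: t)
| FPMulR s t a b : fpstep (s ++ inr a :: inr b :: t) (s ++ inr (a * b)%g :: t).

Inductive fpequiv : fpword -> fpword -> Prop :=
| FPStep s t : fpstep s t -> fpequiv s t
| FPRefl s : fpequiv s s
| FPSym s t : fpequiv s t -> fpequiv t s
| FPTrans s t u : fpequiv s t -> fpequiv t u -> fpequiv s u.

Definition fprel (s t : fpword) : bool := `[< fpequiv s t >].

Lemma fprel_refl : reflexive fprel.
Proof. by move=> s; apply/asboolP/FPRefl. Qed.

Lemma fprel_sym : symmetric fprel.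
Proof. by move=> s t; apply/asboolP/asboolP => /FPSym. Qed.

Lemma fprel_trans : transitive fprel.
Proof.
by move=> t s u /asboolP st /asboolP tu; apply/asboolP/(FPTrans st tu).
Qed.

Canonical fprel_equiv_rel := EquivRel fprel fprel_refl fprel_sym fprel_trans.

Definition freeprod := {eq_quot fprel}.
HB.instance Definition _ : EqQuotient fpword fprel freeprod :=
  EqQuotient.on freeprod.
HB.instance Definition _ := Choice.on freeprod.

Lemma fp_eq s t : fpequiv s t -> \pi_freeprod s = \pi_freeprod t.
Proof. by move=> st; apply/eqP; rewrite piE; apply/asboolP. Qed.

Lemma fp_repr s : fpequiv (repr (\pi_freeprod s)) s.
Proof. by have /eqP := reprK (\pi_freeprod s); rewrite piE => /asboolP. Qed.

Lemma fpstep_cat u v s t : fpstep s t -> fpstep (u ++ s ++ v) (u ++ t ++ v).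
Proof. by case=> {s t} s t *; rewrite -!catA !cat_cons !(catA u); constructor. Qed.

Lemma fpequiv_cat s s' t t' :
  fpequiv s s' -> fpequiv t t' -> fpequiv (s ++ t) (s' ++ t').
Proof.
have cg u v x y : fpequiv x y -> fpequiv (u ++ x ++ v) (u ++ y ++ v).
  elim=> {x y} [x y /(fpstep_cat u v)|x|x y _|x y z _ h _]; first exact: FPStep.
  - exact: FPRefl.
  - exact: FPSym.
  exact: FPTrans.
move=> ss' tt'; apply: FPTrans (cg [::] t _ _ ss') _.
by have := cg s' [::] _ _ tt'; rewrite !cats0.
Qed.

Definition finv (a : G + H) : G + H :=
  match a with inl x => inl x^-1%g | inr y => inr y^-1%g end.
Definition fpword_inv (s : fpword) : fpword := rev (map finv s).

Lemma fpword_invK s : fpequiv (fpword_inv s ++ s) [::].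
Proof.
elim: s => [|a s IHs]; first exact: FPRefl.
rewrite /fpword_inv /= rev_cons cat_rcons; apply: FPTrans _ IHs.
case: a => a /=.
  apply: FPTrans (FPStep (FPMulL _ _ _ _)) _; rewrite mulVg.
  exact/FPStep/FPOneL.
apply: FPTrans (FPStep (FPMulR _ _ _ _)) _; rewrite mulVg.
exact/FPStep/FPOneR.
Qed.

Lemma fpword_invKr s : fpequiv (s ++ fpword_inv s) [::].
Proof.
have finvK : involutive finv by case=> a /=; rewrite invgK.
have E : fpword_inv (fpword_inv s) = s.
  by rewrite /fpword_inv map_rev revK (mapK finvK).
by have := fpword_invK (fpword_inv s); rewrite E.
Qed.

Lemma fpequiv_inv s t : fpequiv s t -> fpequiv (fpword_inv s) (fpword_inv t).
Proof.
move=> st; rewrite -[fpword_inv s]cats0.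
apply: FPTrans (fpequiv_cat (FPRefl _) (FPSym (fpword_invKr t))) _.
rewrite catA -[X in fpequiv _ X]cat0s; apply: fpequiv_cat (FPRefl _).
apply: FPTrans (fpequiv_cat (FPRefl _) (FPSym st)) _.
exact: fpword_invK.
Qed.

Definition fp1 : freeprod := lift_cst freeprod [::].
Definition fpinv := lift_op1 freeprod fpword_inv.
Definition fpmul := lift_op2 freeprod (@cat (G + H)).

Canonical pi_fp1_morph := PiConst fp1.

Lemma pi_fpinv : {morph \pi : s / fpword_inv s >-> fpinv s}.
Proof. by move=> s; unlock fpinv; apply/fp_eq/fpequiv_inv/FPSym/fp_repr. Qed.
Canonical pi_fpinv_morph := PiMorph1 pi_fpinv.

Lemma pi_fpmul : {morph \pi : s t / s ++ t >-> fpmul s t}.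
Proof.
by move=> s t; unlock fpmul; apply/fp_eq/fpequiv_cat; apply/FPSym/fp_repr.
Qed.
Canonical pi_fpmul_morph := PiMorph2 pi_fpmul.

Lemma fpmulA : associative fpmul.
Proof.
by elim/quotW=> s; elim/quotW=> t; elim/quotW=> u; rewrite !piE catA.
Qed.

Lemma fpmul1 : left_id fp1 fpmul.
Proof. by elim/quotW=> s; rewrite !piE. Qed.

Lemma fpmul1r : right_id fp1 fpmul.
Proof. by elim/quotW=> s; rewrite !piE cats0. Qed.

Lemma fpmulV : left_inverse fp1 fpinv fpmul.
Proof. by elim/quotW=> s; rewrite !piE; apply/fp_eq/fpword_invK. Qed.

Lemma fpmulVr : right_inverse fp1 fpinv fpmul.
Proof. by elim/quotW=> s; rewrite !piE; apply/fp_eq/fpword_invKr. Qed.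

HB.instance Definition _ :=
  isGroup.Build freeprod fpmulA fpmul1 fpmul1r fpmulV fpmulVr.

Definition fpinl (x : G) : freeprod := \pi_freeprod [:: inl x].
Definition fpinr (y : H) : freeprod := \pi_freeprod [:: inr y].

Variables (K : groupType) (f : UMagmaMorphism.type G K).
Variable h : UMagmaMorphism.type H K.

Definition fpword_eval (s : fpword) : K :=
  (\big[*%g/1%g]_(a <- s) match a with inl x => f x | inr y => h y end)%g.

Definition fpeval : freeprod -> K := lift_fun1 freeprod fpword_eval.

Lemma fpword_eval_equiv s t : fpequiv s t -> fpword_eval s = fpword_eval t.
Proof.
elim=> {s t} [_ _ [] s t *|//|s t _ -> //|s t u _ -> _ -> //];
  by rewrite /fpword_eval !big_cat /= !big_cons ?gmulfM ?gmulf1 ?mul1g ?mulgA.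
Qed.

Lemma pi_fpeval : {mono \pi : s / fpword_eval s >-> fpeval s}.
Proof. by move=> s; unlock fpeval; apply/fpword_eval_equiv/fp_repr. Qed.
Canonical pi_fpeval_morph := PiMono1 pi_fpeval.

Lemma fpeval_mul : {morph fpeval : x y / (x * y)%g}.
Proof.
elim/quotW=> s; elim/quotW=> t; rewrite -[(_ * _)%g in LHS]/(fpmul _ _) !piE.
by rewrite /fpword_eval big_cat.
Qed.

Lemma fpeval1 : fpeval 1%g = 1%g.
Proof. by rewrite -[1%g in LHS]/fp1 piE /fpword_eval big_nil. Qed.

HB.instance Definition _ := isMultiplicative.Build freeprod K fpeval fpeval_mul.
HB.instance Definition _ :=
  Multiplicative_isUMagmaMorphism.Build freeprod K fpeval fpeval1.

End FreeProduct.

Section Symplectic.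
Variables (k : fieldType) (g : nat).

(* H(L) = L + L^* in coordinates: (x, xi) is the column vector col_mx x xi,
   where xi : 'cV_g holds the coordinates in the basis dual to the standard
   basis of L = k^g, i.e. xi(y) = \sum_i xi_i y_i. *)
Definition pairing (xi y : 'cV[k]_g) : k := \sum_i xi i 0 * y i 0.

Definition omega (u v : 'cV[k]_(g + g)) : k :=
  pairing (dsubmx u) (usubmx v) - pairing (dsubmx v) (usubmx u).

Definition Sp := {A : 'M[k]_(g + g) |
  `[< forall u v, omega (A *m u) (A *m v) = omega u v >]}.

Definition Jmx : 'M[k]_(g + g) := block_mx 0 (- 1%:M) 1%:M 0.

Lemma JmxK : Jmx *m Jmx = - 1%:M.
Proof.
rewrite mulmx_block !(mul0mx, mulmx0, mul1mx, mulmx1, addr0, add0r).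
by rewrite [in RHS]scalar_mx_block opp_block_mx !oppr0.
Qed.

Lemma omegaE u v : omega u v = (u^T *m Jmx *m v) 0 0.
Proof.
have pE (x y : 'cV[k]_g) : pairing x y = (x^T *m y) 0 0.
  by rewrite mxE; apply: eq_bigr => i _; rewrite mxE.
rewrite -{2}(vsubmxK u) -{2}(vsubmxK v) tr_col_mx mul_row_block mul_row_col.
rewrite !(mulmx0, mulmx1, addr0, add0r) mulmxN mulmx1 mulNmx.
rewrite [RHS]mxE [X in _ + X]mxE -pE /omega; congr (_ - _).
rewrite mxE; apply: eq_bigr => i _.
by rewrite [X in _ = X * _]mxE mulrC.
Qed.

Lemma SpP (A : 'M[k]_(g + g)) :
  (forall u v, omega (A *m u) (A *m v) = omega u v) <-> A^T *m Jmx *m A = Jmx.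
Proof.
split=> [AP|AJ u v]; last first.
  by rewrite !omegaE trmx_mul !mulmxA -(mulmxA u^T) -(mulmxA u^T) AJ.
apply/matrixP => i j; have := AP (delta_mx i 0) (delta_mx j 0).
rewrite !omegaE trmx_mul !mulmxA -(mulmxA _ A^T) -(mulmxA _ (A^T *m _)).
by rewrite !trmx_delta -!rowE -!colE !mxE.
Qed.

Lemma Sp_isom (x : Sp) u v : omega (val x *m u) (val x *m v) = omega u v.
Proof. by case: x => A /= /asboolP. Qed.

Lemma Sp_unit (x : Sp) : val x \in unitmx.
Proof.
have /SpP xJ := Sp_isom x.
have : - (Jmx *m (val x)^T *m Jmx) *m val x = 1%:M.
  by rewrite mulNmx -!mulmxA (mulmxA _ Jmx) xJ JmxK opprK.
by case/mulmx1_unit.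
Qed.

Lemma Sp1_proof u v : omega (1%:M *m u) (1%:M *m v) = omega u v.
Proof. by rewrite !mul1mx. Qed.

Lemma SpM_proof (x y : Sp) u v :
  omega (val x *m val y *m u) (val x *m val y *m v) = omega u v.
Proof. by rewrite -!mulmxA !Sp_isom. Qed.

Lemma SpV_proof (x : Sp) u v :
  omega (invmx (val x) *m u) (invmx (val x) *m v) = omega u v.
Proof. by rewrite -(Sp_isom x) !mulKVmx ?Sp_unit. Qed.

Definition mkSp (A : 'M[k]_(g + g))
    (h : forall u v, omega (A *m u) (A *m v) = omega u v) : Sp :=
  exist (fun A => is_true `[< forall u v, omega (A *m u) (A *m v) = omega u v >])
    A (asboolT h).

Definition Sp_one : Sp := mkSp Sp1_proof.
Definition Sp_mul (x y : Sp) : Sp := mkSp (SpM_proof x y).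
Definition Sp_inv (x : Sp) : Sp := mkSp (SpV_proof x).

HB.instance Definition _ := SubChoice.on Sp.

Lemma Sp_mulA : associative Sp_mul.
Proof. by move=> x y z; apply/val_inj/mulmxA. Qed.

Lemma Sp_mul1 : left_id Sp_one Sp_mul.
Proof. by move=> x; apply/val_inj/mul1mx. Qed.

Lemma Sp_mul1r : right_id Sp_one Sp_mul.
Proof. by move=> x; apply/val_inj/mulmx1. Qed.

Lemma Sp_mulV : left_inverse Sp_one Sp_inv Sp_mul.
Proof. by move=> x; apply/val_inj/mulVmx/Sp_unit. Qed.

Lemma Sp_mulVr : right_inverse Sp_one Sp_inv Sp_mul.
Proof. by move=> x; apply/val_inj/mulmxV/Sp_unit. Qed.

HB.instance Definition _ :=
  isGroup.Build Sp Sp_mulA Sp_mul1 Sp_mul1r Sp_mulV Sp_mulVr.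

Lemma Sp_val1 : val (1%g : Sp) = 1%:M. Proof. by []. Qed.
Lemma Sp_valM (x y : Sp) : val (x * y)%g = val x *m val y. Proof. by []. Qed.
Lemma Sp_valV (x : Sp) : val (x^-1)%g = invmx (val x). Proof. by []. Qed.

(* The pointwise stabilizers of L and of L^*. *)
Definition fixL : {pred Sp} := fun x =>
  `[< forall y : 'cV[k]_g, val x *m col_mx y 0 = col_mx y 0 >].
Definition fixLd : {pred Sp} := fun x =>
  `[< forall eta : 'cV[k]_g, val x *m col_mx 0 eta = col_mx 0 eta >].

Lemma fixL_group_closed : group_closed fixL.
Proof.
split; first by apply/asboolP => y; rewrite Sp_val1 mul1mx.
move=> a b /asboolP fa /asboolP fb; apply/asboolP => y.
by rewrite Sp_valM Sp_valV -mulmxA -{1}(fb y) mulKmx ?Sp_unit.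
Qed.

Lemma fixLd_group_closed : group_closed fixLd.
Proof.
split; first by apply/asboolP => y; rewrite Sp_val1 mul1mx.
move=> a b /asboolP fa /asboolP fb; apply/asboolP => y.
by rewrite Sp_valM Sp_valV -mulmxA -{1}(fb y) mulKmx ?Sp_unit.
Qed.

Definition stabL := {x : Sp | fixL x}.
HB.instance Definition _ := SubChoice.on stabL.
HB.instance Definition _ :=
  SubChoice_isSubGroup.Build Sp fixL stabL fixL_group_closed.

Definition stabLd := {x : Sp | fixLd x}.
HB.instance Definition _ := SubChoice.on stabLd.
HB.instance Definition _ :=
  SubChoice_isSubGroup.Build Sp fixLd stabLd fixLd_group_closed.

(* E(q) for q : L^* -> L and for q : L -> L^* respectively. *)
Definition Eup_mx (q : 'M[k]_g) : 'M[k]_(g + g) := block_mx 1%:M q 0 1%:M.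
Definition Elow_mx (q : 'M[k]_g) : 'M[k]_(g + g) := block_mx 1%:M 0 q 1%:M.

Lemma Eup_Sp_proof (q : symmx k g) u v :
  omega (Eup_mx (val q) *m u) (Eup_mx (val q) *m v) = omega u v.
Proof.
apply/SpP: u v; rewrite tr_block_mx symmxP /Jmx !mulmx_block !trmx1 trmx0.
rewrite !(mul0mx, mulmx0, mul1mx, mulmx1, addr0, add0r, mulmxN, mulNmx, oppr0).
by rewrite addrN.
Qed.

Lemma Elow_Sp_proof (q : symmx k g) u v :
  omega (Elow_mx (val q) *m u) (Elow_mx (val q) *m v) = omega u v.
Proof.
apply/SpP: u v; rewrite tr_block_mx symmxP /Jmx !mulmx_block !trmx1 trmx0.
rewrite !(mul0mx, mulmx0, mul1mx, mulmx1, addr0, add0r, mulmxN, mulNmx, oppr0).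
by rewrite addrN.
Qed.

Definition Eup_Sp (q : symmx k g) : Sp := mkSp (Eup_Sp_proof q).
Definition Elow_Sp (q : symmx k g) : Sp := mkSp (Elow_Sp_proof q).

Lemma Eup_stab_proof (q : symmx k g) (y : 'cV[k]_g) :
  val (Eup_Sp q) *m col_mx y 0 = col_mx y 0.
Proof.
by rewrite mul_block_col !(mul0mx, mulmx0, mul1mx, addr0).
Qed.

Lemma Elow_stab_proof (q : symmx k g) (eta : 'cV[k]_g) :
  val (Elow_Sp q) *m col_mx 0 eta = col_mx 0 eta.
Proof.
by rewrite mul_block_col !(mul0mx, mulmx0, mul1mx, add0r).
Qed.

Definition Eup (q : symmx k g) : stabL :=
  exist (fun x => is_true (fixL x)) (Eup_Sp q) (asboolT (Eup_stab_proof q)).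
Definition Elow (q : symmx k g) : stabLd :=
  exist (fun x => is_true (fixLd x)) (Elow_Sp q) (asboolT (Elow_stab_proof q)).

Definition SLSLd := freeprod stabL stabLd.

(* The evaluation homomorphism, whose fibre over x is the set of lifts of x. *)
Definition Eval : SLSLd -> Sp :=
  @fpeval stabL stabLd Sp (val : stabL -> Sp) (val : stabLd -> Sp).
HB.instance Definition _ := UMagmaMorphism.on Eval.

End Symplectic.

Section Sturm.
Variables (k : fieldType) (g : nat).

(* The sequence (q_m, ..., q_n) with m = st_m and n = st_m + st_l; the letter
   q_j is st_q i for j = st_m + i. *)
Record sturm := Sturm {
  st_m : int;
  st_l : nat;
  st_q : 'I_st_l.+1 -> symmx k g
}.

Definition evenz (j : int) : bool := (2 %| j)%Z.

Definition letter (j : int) (q : symmx k g) : SLSLd k g :=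
  if evenz j then @fpinr (stabL k g) (stabLd k g) (Elow q)
  else @fpinl (stabL k g) (stabLd k g) (Eup q).

Definition sturm_word (s : sturm) : SLSLd k g :=
  (\prod_(i < (st_l s).+1) letter (st_m s + i%:Z) (st_q i))%g.

Definition type00 (s : sturm) : Prop :=
  evenz (st_m s) /\ evenz (st_m s + (st_l s)%:Z).

Definition sylvester_mx (s : sturm) :
    'M[k]_(\sum_(i < (st_l s).+1) g, \sum_(i < (st_l s).+1) g) :=
  \mxblock_(i < (st_l s).+1, j < (st_l s).+1)
    if i == j then (-1) ^ (st_m s + i%:Z) *: val (st_q i)
    else if (i.+1 == j :> nat) || (j.+1 == i :> nat) then 1%:M
    else 0.

Lemma sylvester_proof (s : sturm) : (sylvester_mx s)^T == sylvester_mx s.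
Proof.
apply/eqP; rewrite tr_mxblock; apply: eq_mxblock => i j.
rewrite eq_sym; case: eqP => [->|_]; first by rewrite linearZ /= symmxP.
by rewrite orbC; case: ifP; rewrite ?trmx1 ?trmx0.
Qed.

Definition sylvester (s : sturm) : symmx k (\sum_(i < (st_l s).+1) g) :=
  exist (fun A => is_true (A^T == A)) (sylvester_mx s) (sylvester_proof s).

(* f00 w is the common value of the Witt classes of the Sylvester forms of all
   type 00 representatives of w; mu x y is the common value of the differences
   for all lifts a of x and b of y. *)
Definition f00 (w : SLSLd k g) : witt k :=
  xget 0 [set c | exists s : sturm,
    [/\ type00 s, sturm_word s = w & c = witt_class (sylvester s)]]%classic.

Definition mu (x y : Sp k g) : witt k :=
  xget 0 [set c | exists a b : SLSLd k g,
    [/\ Eval a = x, Eval b = y &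
        c = f00 (a * b)%g - f00 a - f00 b]]%classic.

End Sturm.

Definition modI2 (k : fieldType) (a : witt k) : witt_I2 k := \pi_(witt_I2 k) a.

(* Main.v *)
Require Import Defs.
From mathcomp Require Import all_boot all_order all_algebra.
From mathcomp Require Import boolp classical_sets.
From mathcomp Require Import ring.
From mathcomp.real_closed Require Import mxtens.

Import GRing.Theory.
Set Implicit Arguments.
Unset Strict Implicit.
Unset Printing Implicit Defensive.
Local Open Scope ring_scope.
Local Open Scope quotient_scope.

(** Write f for f00 and call a word a relation if it evaluates to 1 in Sp.

    The Sylvester form of a word is built by prepending letters to a form S
    with a marked family d of g coordinates (its first block): a letter of
    the stabilizer of L^* turns S into S + d y d^T, and a letter x of the
    stabilizer of L prepends the two blocks 0 and -x.  Two consecutive blocks a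
    and b separated by a zero block can be merged into a + b after splitting
    off a metabolic space ([reduces_prepend00]); this is what the defining
    identities of the free product ask for, so the Witt class depends only on
    the element of the free product ([f00_pi]).

    For a word w, the recursion defined by the block tridiagonal matrix S
    produces X with S X = d Y and d^T X = Z, where (Z, Y) is, up to sign, the
    image of L under the symplectic matrix of w ([strip_solution]).  If w is a
    relation then Y = 0 and X is a part of the radical of S that projects
    isomorphically to each of the two end blocks.  The form of a product uv is
    the restriction of the orthogonal sum of the forms of u and v to the
    subspace on which the last coordinates of the first factor agree with the
    first coordinates of the second ([strip_glue]); when u or v is a relation,
    the radical vectors X provide a projection onto this subspace that
    preserves the form, hence f(uv) = f(u) + f(v) ([strip_class_kerl],
    [strip_class_kerr]).  It follows that mu is well defined ([mu_lift]), and
    that f mod I^2 descends to Sp as soon as relations have class in I^2.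

    Modulo I^2, a nondegenerate form of rank r and determinant D has class
    <D> + (r - 1)<1> ([modI2_disc]).  The same solution X computes the
    determinant: det S = det Y ([det_strip]).  Multiplying a relation n on the
    left by the letter y = 1 makes Y invertible, equal to a sign, so that the
    rank and the determinant are known and give f(n) = 0 mod I^2
    ([kernel_class]).

    Finally two solutions of the functional equation differ by a homomorphism
    chi from Sp to W/I^2.  The group Sp is generated by the two stabilizers
    ([Eval_surjective]), and conjugation by diag(2, 1/2) multiplies the
    symmetric map of an element of a stabilizer by 4 or 1/4, so that 3 chi = 0
    there, while 4 kills W/I^2.  Hence chi = 0. *)

(** * Witt classes of possibly degenerate forms *)

Ltac mx01_simpl := rewrite ?(mul0mx, mulmx0, mul1mx, mulmx1, addr0, add0r, trmx0,
  trmx1, oppr0).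

Ltac block_simpl := rewrite ?(mul_row_block, mulmx_block, mul_row_col,
  mul_col_row, mul_block_col, mul_mx_row, mul_col_mx, add_row_mx, add_col_mx,
  add_block_mx, opp_row_mx, opp_col_mx, opp_block_mx, mul0mx, mulmx0, mul1mx,
  mulmx1, mulmxN, mulNmx, addr0, add0r, oppr0, opprK, trmx0, trmx1, row_mx0, col_mx0,
    block_mx0).

Section WittClasses.
Context {k : fieldType}.

(** The forms represent each other by linear maps that need not be injective.
    On the nondegenerate quotients this is isometry, and it lets degenerate
    forms be compared without choosing complements of their radicals. *)
Definition mutual {m n} (A : 'M[k]_m) (B : 'M[k]_n) : Prop :=
  (exists P : 'M_(m, n), P^T *m A *m P = B) /\
  (exists Q : 'M_(n, m), Q^T *m B *m Q = A).

Lemma mutual_refl n (A : 'M[k]_n) : mutual A A.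
Proof. by split; exists 1%:M; rewrite trmx1 mul1mx mulmx1. Qed.

Lemma mutual_sym m n (A : 'M[k]_m) (B : 'M[k]_n) : mutual A B -> mutual B A.
Proof. by case. Qed.

Lemma mutual_trans m n p (A : 'M[k]_m) (B : 'M[k]_n) (C : 'M[k]_p) :
  mutual A B -> mutual B C -> mutual A C.
Proof.
case=> -[P <-] [Q QA] [] [P' <-] [Q' QB]; split.
  by exists (P *m P'); rewrite trmx_mul !mulmxA.
exists (Q' *m Q); by rewrite trmx_mul -[RHS]QA -[X in _ = _ *m X *m _]QB !mulmxA.
Qed.

Lemma mutual_osum m n m' n' (A : 'M[k]_m) (B : 'M[k]_n) (A' : 'M_m') (B' : 'M_n') :
  mutual A A' -> mutual B B' -> mutual (osum A B) (osum A' B').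
Proof.
have half a b c d (E : 'M[k]_a) (F : 'M[k]_b) (P : 'M_(a, c)) (Q : 'M_(b, d)) :
    (block_mx P 0 0 Q)^T *m osum E F *m block_mx P 0 0 Q
    = osum (P^T *m E *m P) (Q^T *m F *m Q).
  by rewrite tr_block_mx /osum !mulmx_block !(mul0mx, mulmx0, addr0, add0r, trmx0).
case=> -[P PA] [Q QA] [] [P' PB] [Q' QB]; split.
  by exists (block_mx P 0 0 P'); rewrite half PA PB.
by exists (block_mx Q 0 0 Q'); rewrite half QA QB.
Qed.

Lemma iso_mutual m n (A : 'M[k]_m) (B : 'M[k]_n) : isometric A B -> mutual A B.
Proof.
move=> AB; have [Q [_ [_ _ QB]]] := iso_sym AB.
by case: AB => P [_ [_ _ PA]]; split; [exists P | exists Q].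
Qed.

(** Each matrix pulls a nondegenerate form back to a nondegenerate form, so both
    have full rank: the dimensions agree and P is invertible. *)
Lemma mutual_iso m n (A : 'M[k]_m) (B : 'M[k]_n) :
  A \in unitmx -> B \in unitmx -> mutual A B -> isometric A B.
Proof.
move=> uA uB [[P PA] [Q QB]].
have le a b (E : 'M[k]_a) (R : 'M_(a, b)) : R^T *m E *m R \in unitmx -> b = \rank R.
  move=> /mxrank_unit h; apply/eqP; rewrite eqn_leq rank_leq_col andbT.
  by rewrite -{1}h mxrankM_maxr.
have nP : n = \rank P by apply: (le _ _ A P); rewrite PA.
have mQ : m = \rank Q by apply: (le _ _ B Q); rewrite QB.
have mn : m = n.
  by apply/eqP; rewrite eqn_leq; move: (rank_leq_row P) (rank_leq_row Q);
    rewrite -nP -mQ => -> ->.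
subst n; exists P, (invmx P).
have uP : P \in unitmx by rewrite -row_full_unit /row_full -nP.
by rewrite mulmxV ?mulVmx.
Qed.

Lemma pi_witt_mutual (x y : ispace k) :
  mutual (gram x) (gram y) -> \pi_(witt k) x = \pi_(witt k) y.
Proof.
move=> xy; apply/witt_eq/iso_witt/mutual_iso => //.
  by case: (ispaceP x).
by case: (ispaceP y).
Qed.

Lemma pi_witt_metabolic (x : ispace k) : metabolic (gram x) -> \pi_(witt k) x = 0.
Proof. by move=> /metabolic_witt0/witt_eq ->; rewrite -[0]/(witt0 k) !piE. Qed.

Lemma pi_wittDE (x y : ispace k) :
  \pi_(witt k) (iadd x y) = \pi_(witt k) x + \pi_(witt k) y.
Proof. by rewrite -[_ + _]/(wittD _ _) !piE. Qed.

(** The Witt class on plain matrices, so that no proof of symmetry has to be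
    carried; the value 0 is a default for matrices that are not symmetric. *)
Definition form_class {n} (A : 'M[k]_n) : witt k :=
  if insub A is Some q then witt_class (q : symmx k n) else 0.

Lemma form_classE n (q : symmx k n) : form_class (val q) = witt_class q.
Proof. by rewrite /form_class valK. Qed.

Lemma quot_gram_mutual n (A : symmx k n) : mutual (val A) (quot_gram (val A)).
Proof.
split; first by exists (pinvmx (row_base (val A))).
by exists (row_base (val A)); apply: quot_gramE.
Qed.

Lemma form_class_pi n (A : 'M[k]_n) (x : ispace k) :
  mutual A (gram x) -> form_class A = \pi_(witt k) x.
Proof.
move=> Ax; have AT : A^T == A.
  have [_ [Q <-]] := Ax; rewrite !trmx_mul trmxK mulmxA.
  by have [-> _] := ispaceP x.
rewrite -[A]/(val (exist (fun A => is_true (A^T == A)) A AT : symmx k n)) form_classE.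
apply: pi_witt_mutual; apply: mutual_trans (mutual_sym (quot_gram_mutual _)) _.
exact: Ax.
Qed.

Lemma sym_pi n (A : 'M[k]_n) : A^T = A -> exists x : ispace k, mutual A (gram x).
Proof.
move=> /eqP AT; pose q : symmx k n := exist (fun A => is_true (A^T == A)) A AT.
by exists (mk_ispace (quot_gram_proof q)); apply: (quot_gram_mutual q).
Qed.

Lemma form_class_mutual m n (A : 'M[k]_m) (B : 'M[k]_n) :
  A^T = A -> mutual A B -> form_class A = form_class B.
Proof.
move=> /sym_pi[x Ax] AB; rewrite (form_class_pi Ax); apply/esym/form_class_pi.
exact: mutual_trans (mutual_sym AB) Ax.
Qed.

Lemma form_class_osum m n (A : 'M[k]_m) (B : 'M[k]_n) : A^T = A -> B^T = B ->
  form_class (osum A B) = form_class A + form_class B.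
Proof.
move=> /sym_pi[x Ax] /sym_pi[y By]; rewrite (form_class_pi Ax) (form_class_pi By).
by rewrite -pi_wittDE; apply/form_class_pi/mutual_osum.
Qed.

Lemma form_class_metabolic n (A : 'M[k]_n) :
  A^T = A -> A \in unitmx -> metabolic A -> form_class A = 0.
Proof.
move=> AT uA mA; have h : A^T = A /\ A \in unitmx by [].
rewrite (@form_class_pi _ _ (mk_ispace h)); last exact: mutual_refl.
exact: pi_witt_metabolic.
Qed.

End WittClasses.

(** * Reduction of a form with a marked family of linear functionals *)

Section Reduction.
Context {k : fieldType} {g : nat}.

(** Up to radicals, (S, d) is the orthogonal sum of (S', d') and of a form N of
    trivial class on which the functionals d vanish: Pa and Pb map the summands
    to the whole space, and Qa, Qb map it back.  Keeping track of
    d is what makes the relation compatible with the two ways of prepending a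
    letter. *)
Definition reduces {m n} (S : 'M[k]_m) (d : 'M[k]_(m, g))
    (S' : 'M[k]_n) (d' : 'M[k]_(n, g)) : Prop :=
  exists p (N : 'M[k]_p) (Pa : 'M_(m, n)) (Pb : 'M_(m, p)) (Qa : 'M_(n, m))
      (Qb : 'M_(p, m)),
    [/\ N^T = N /\ form_class N = 0,
        [/\ Pa^T *m S *m Pa = S', Pa^T *m S *m Pb = 0,
            Pb^T *m S *m Pa = 0 & Pb^T *m S *m Pb = N],
        Pa^T *m d = d' /\ Pb^T *m d = 0 & Pa *m Qa + Pb *m Qb = 1%:M].

Lemma form_class_reduces m n (S : 'M[k]_m) d (S' : 'M[k]_n) d' :
  S^T = S -> reduces S d S' d' -> form_class S = form_class S'.
Proof.
move=> ST [p [N [Pa [Pb [Qa [Qb]]]]]] [[NT N0] [Eaa Eab Eba Ebb] _ PQ].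
have S'T : S'^T = S' by rewrite -Eaa !trmx_mul trmxK ST mulmxA.
rewrite -[form_class S']addr0 -N0 -form_class_osum //; apply: form_class_mutual => //.
have E : (row_mx Pa Pb)^T *m S *m row_mx Pa Pb = osum S' N.
  by rewrite tr_row_mx mul_col_mx mul_col_row Eaa Eab Eba Ebb.
split; first by exists (row_mx Pa Pb).
exists (col_mx Qa Qb); rewrite -E !mulmxA -trmx_mul -!mulmxA mul_row_col PQ.
by rewrite trmx1 mul1mx mulmx1.
Qed.

Lemma form_class_empty (N : 'M[k]_0) : form_class N = 0.
Proof.
by apply: form_class_metabolic; [apply/matrixP =>
  -[]|rewrite unitmxE det_mx00 unitr1|apply: metabolic0].
Qed.

(** A right inverse Q of P is enough, since pulling back along P and then along
    Q gives S again; P may have a kernel, which only enlarges the radical. *)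
Lemma iso_reduces m n (S : 'M[k]_m) d (P : 'M_(m, n)) (Q : 'M_(n, m)) :
  P *m Q = 1%:M -> reduces S d (P^T *m S *m P) (P^T *m d).
Proof.
move=> PQ; exists 0, 0, P, 0, Q, 0; split=> //.
- by split; [rewrite trmx0 | apply: form_class_empty].
- by split=> //; try (by apply/matrixP => i []); try (by apply/matrixP => -[]).
- by split=> //; apply/matrixP => -[].
by rewrite mul0mx addr0.
Qed.

Lemma reduces_refl m (S : 'M[k]_m) d : reduces S d S d.
Proof.
have := iso_reduces S d (mulmx1 (1%:M : 'M[k]_m)).
by rewrite trmx1 !mul1mx mulmx1.
Qed.

Lemma reduces_trans m n q (S : 'M[k]_m) d (S' : 'M[k]_n) d' (S'' : 'M[k]_q) d'' :
  reduces S d S' d' -> reduces S' d' S'' d'' -> reduces S d S'' d''.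
Proof.
case=> p [N [Pa [Pb [Qa [Qb]]]]] [[NT N0] [Eaa Eab Eba Ebb] [da db] PQ].
case=> p' [N' [Pa' [Pb' [Qa' [Qb']]]]] [[NT' N0'] [Eaa' Eab' Eba' Ebb'] [da' db'] PQ'].
exists (p + p')%N, (osum N N'), (Pa *m Pa'), (row_mx Pb (Pa *m Pb')), (Qa' *m Qa).
exists (col_mx Qb (Qb' *m Qa)); split.
- by split; [rewrite tr_block_mx NT NT' !trmx0 | rewrite form_class_osum // N0 N0'
  addr0].
- have aa r s (X : 'M_(n, r)) (Y : 'M_(n, s)) :
      (Pa *m X)^T *m S *m (Pa *m Y) = X^T *m S' *m Y.
    by rewrite trmx_mul -Eaa !mulmxA.
  have ab r (X : 'M_(n, r)) : (Pa *m X)^T *m S *m Pb = 0.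
    by rewrite trmx_mul -!mulmxA (mulmxA Pa^T) Eab mulmx0.
  have ba r (X : 'M_(n, r)) : Pb^T *m S *m (Pa *m X) = 0.
    by rewrite mulmxA Eba mul0mx.
  split.
  + by rewrite aa.
  + by rewrite mul_mx_row ab aa Eab' row_mx0.
  + by rewrite tr_row_mx !mul_col_mx ba aa Eba' col_mx0.
  by rewrite tr_row_mx mul_col_mx mul_col_row Ebb ba ab aa Ebb'.
- split; first by rewrite trmx_mul -mulmxA da.
  by rewrite tr_row_mx mul_col_mx db trmx_mul -mulmxA da db' col_mx0.
rewrite mul_row_col -!mulmxA (mulmxA Pa') (mulmxA Pb') addrCA -mulmxDr -mulmxDl.
by rewrite PQ' mul1mx addrC.
Qed.

(** The Gram matrix after a new first block a is coupled to the marked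
    coordinates d; the new marked coordinates are [first_inc]. *)
Definition prepend_form {n} (a : 'M[k]_g) (S : 'M[k]_n) (d : 'M_(n, g)) :=
  block_mx a d^T d S.
Definition first_inc n : 'M[k]_(g + n, g) := col_mx 1%:M 0.

(** Adding y to the first diagonal block, without assuming that S is given in
    blocks. *)
Definition retouch_form {n} (y : 'M[k]_g) (S : 'M[k]_n) (d : 'M_(n, g)) :=
  S + d *m y *m d^T.

Lemma reduces_retouch m n (S : 'M[k]_m) d (S' : 'M[k]_n) d' y :
  reduces S d S' d' -> reduces (retouch_form y S d) d (retouch_form y S' d') d'.
Proof.
case=> p [N [Pa [Pb [Qa [Qb]]]]] [hN [Eaa Eab Eba Ebb] [da db] PQ].
have E r s (X : 'M_(m, r)) (Y : 'M_(m, s)) : X^T *m retouch_form y S d *m Y =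
    X^T *m S *m Y + (X^T *m d) *m y *m (Y^T *m d)^T.
  by rewrite /retouch_form mulmxDr mulmxDl trmx_mul trmxK !mulmxA.
exists p, N, Pa, Pb, Qa, Qb; split=> //; split; rewrite E.
- by rewrite da Eaa.
- by rewrite db trmx0 mulmx0 addr0.
- by rewrite db !mul0mx addr0.
by rewrite db !mul0mx addr0.
Qed.

Lemma reduces_prepend m n (S : 'M[k]_m) d (S' : 'M[k]_n) d' a :
  reduces S d S' d' -> reduces (prepend_form a S d) (first_inc m)
    (prepend_form a S' d') (first_inc n).
Proof.
case=> p [N [Pa [Pb [Qa [Qb]]]]] [hN [Eaa Eab Eba Ebb] [da db] PQ].
exists p, N, (block_mx 1%:M 0 0 Pa), (col_mx 0 Pb), (block_mx 1%:M 0 0 Qa).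
exists (row_mx 0 Qb); split=> //.
- have daT : d^T *m Pa = d'^T by rewrite -da trmx_mul trmxK.
  have dbT : d^T *m Pb = 0 by apply: trmx_inj; rewrite trmx_mul trmxK db trmx0.
  rewrite /prepend_form tr_block_mx tr_col_mx.
  rewrite !(mul_row_block, mulmx_block, mul_row_col, mul_block_col, trmx0, trmx1).
  rewrite !(mul0mx, mulmx0, mul1mx, mulmx1, addr0, add0r).
  rewrite da db daT dbT Eaa Eab Eba Ebb; split=> //.
    by rewrite col_mx0.
  by rewrite row_mx0.
- rewrite /first_inc tr_block_mx tr_col_mx mul_block_col mul_row_col !(trmx0, trmx1).
  by split; rewrite !(mul0mx, mulmx0, mul1mx, mulmx1, addr0, add0r).
rewrite mulmx_block mul_col_row add_block_mx.
by rewrite !(mul0mx, mulmx0, mul1mx, mulmx1, addr0, add0r) PQ -scalar_mx_block.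
Qed.

Lemma prepend_formD n a y (S : 'M[k]_n) d :
  prepend_form (a + y) S d = retouch_form y (prepend_form a S d) (first_inc n).
Proof.
rewrite /retouch_form /first_inc tr_col_mx mul_col_mx mul_col_row add_block_mx.
by rewrite !(trmx0, trmx1, mul0mx, mulmx0, mul1mx, mulmx1, addr0).
Qed.

Lemma form_class_hyperbolic (b : 'M[k]_g) : b^T = b ->
  (block_mx 0 1%:M 1%:M b)^T = block_mx 0 1%:M 1%:M b /\
  form_class (block_mx 0 1%:M 1%:M b) = 0.
Proof.
move=> bT; have hT : (block_mx 0 1%:M 1%:M b)^T = block_mx 0 1%:M 1%:M b.
  by rewrite tr_block_mx trmx0 trmx1 bT.
split=> //; apply: form_class_metabolic => //.
  have : block_mx 0 1%:M 1%:M b *m block_mx (- b) 1%:M 1%:M 0 = 1%:M.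
    by rewrite mulmx_block; mx01_simpl; rewrite addNr -scalar_mx_block.
  by case/mulmx1_unit.
exists g, (col_mx 1%:M 0); split=> //; last first.
  by rewrite tr_col_mx mul_row_block mul_row_col; mx01_simpl.
apply/eqP; rewrite eqn_leq rank_leq_col /=.
have := mxrankM_maxr (row_mx 1%:M (0 : 'M[k]_g)) (col_mx 1%:M (0 : 'M[k]_g)).
by rewrite mul_row_col mulmx1 mul0mx addr0 mxrank1.
Qed.

(** Let e1, e2 be the two new blocks.  The block e2 is isotropic and pairs to 1
    with the old first block d, so e2 and d span a metabolic space N.  Its
    orthogonal complement is the graph Pa, on which -v replaces v and the
    e1-coordinate is d^T v, so that the marked coordinates are unchanged. *)
Lemma reduces_prepend00 n (S : 'M[k]_n) d : S^T = S -> d^T *m d = 1%:M ->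
  reduces (prepend_form 0 (prepend_form 0 S d) (first_inc n)) (first_inc (g + n)) S d.
Proof.
move=> ST dd.
exists (g + g)%N, (block_mx 0 1%:M 1%:M (d^T *m S *m d)).
exists (col_mx d^T (col_mx (d^T *m S) (- 1%:M))).
exists (block_mx 0 0 (col_mx 1%:M 0) (col_mx 0 d)).
exists (row_mx d (row_mx 0 (d *m d^T - 1%:M))).
exists (col_mx (row_mx (- (d^T *m S *m d))
  (row_mx 1%:M (- (d^T *m S *m (d *m d^T - 1%:M)))))
  (row_mx 1%:M (row_mx 0 d^T))).
split.
- by apply: form_class_hyperbolic; rewrite !trmx_mul trmxK ST mulmxA.
- rewrite /prepend_form /first_inc.
  rewrite !tr_block_mx !tr_col_mx !(trmx0, trmx1, linearN, trmx_mul, trmxK, ST) /=.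
  rewrite trmx1; split; block_simpl; rewrite ?dd //.
  + by rewrite subrr mul0mx add0r opprB addrC subrK.
  + by rewrite subrr mulmxBl -[_ *m d^T *m d]mulmxA dd mulmx1 subrr row_mx0.
  by rewrite mul1mx !subrr col_mx0.
- rewrite /first_inc tr_col_mx tr_block_mx !tr_col_mx trmxK.
  by rewrite !(mul_row_col, mul_block_col, trmx0, mul0mx, mulmx0, mulmx1, addr0,
    col_mx0).
block_simpl.
rewrite mulmxBr mulmx1 mulmxA dd mul1mx !subrr addNr opprB subrK row_mx0 col_mx0.
by rewrite -[col_mx (row_mx _ _) (row_mx _ _)]/(block_mx _ _ _ _)
   -[col_mx (row_mx 1%:M 0) _]/(block_mx _ _ _ _) -!scalar_mx_block.
Qed.
End Reduction.

(** * Strips: Sylvester forms with their two ends marked *)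

Section Strips.
Variables (k : fieldType) (g : nat).

(** A form with marked first and last blocks of dimension g.  The columns of
    [sfirst] are both the basis of the first block and, transposed, its
    coordinates; likewise for [slast]. *)
Record strip := Strip {
  sdim : nat;
  sform : 'M[k]_sdim;
  sfirst : 'M[k]_(sdim, g);
  slast : 'M[k]_(sdim, g)
}.

(** A sequence of type 00 has at least one letter, so the empty word is
    represented by one zero block, which is both the first and the last. *)
Definition strip0 : strip := @Strip g 0 1%:M 1%:M.

Definition prepend (a : 'M[k]_g) (s : strip) : strip :=
  @Strip (g + sdim s) (prepend_form a (sform s) (sfirst s)) (first_inc (sdim s))
    (col_mx 0 (slast s)).

Definition retouch (y : 'M[k]_g) (s : strip) : strip :=
  @Strip (sdim s) (retouch_form y (sform s) (sfirst s)) (sfirst s) (slast s).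

Definition strip_wf (s : strip) : Prop :=
  (sform s)^T = sform s /\ (sfirst s)^T *m sfirst s = 1%:M.

Definition sreduces (s t : strip) : Prop :=
  reduces (sform s) (sfirst s) (sform t) (sfirst t).

Lemma strip0_wf : strip_wf strip0.
Proof. by split; rewrite ?trmx0 // trmx1 mulmx1. Qed.

Lemma prepend_wf a s : a^T = a -> strip_wf s -> strip_wf (prepend a s).
Proof.
move=> aT [sT _]; split; first by rewrite tr_block_mx aT trmxK sT.
by rewrite tr_col_mx mul_row_col trmx1 trmx0 mulmx1 mulmx0 addr0.
Qed.

Lemma retouch_wf y s : y^T = y -> strip_wf s -> strip_wf (retouch y s).
Proof.
move=> yT [sT dd]; split=> //=.
by rewrite linearD /= sT !trmx_mul trmxK yT mulmxA.
Qed.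

Definition up_form (x : stabL k g) : 'M[k]_g := ursubmx (val (val x)).
Definition low_form (y : stabLd k g) : 'M[k]_g := dlsubmx (val (val y)).

Lemma Sp_mulJ (x : Sp k g) : (val x)^T *m Jmx k g *m val x = Jmx k g.
Proof. exact/SpP/Sp_isom. Qed.

(** Fixing L pointwise forces the first block column, and then invariance of the
    symplectic form forces the lower right block to be 1 and the upper right
    block to be symmetric. *)
Lemma stabL_mx (x : stabL k g) :
  val (val x) = Eup_mx (up_form x) /\ (up_form x)^T = up_form x.
Proof.
have xJ := Sp_mulJ (val x); have /asboolP fx := valP x.
rewrite /up_form; move: (val (val x)) xJ fx => A xJ fx.
have E : lsubmx A = col_mx 1%:M 0.
  apply/matrixP => i j; have := fx (delta_mx j 0).
  rewrite -{1}[A]hsubmxK mul_row_col mulmx0 addr0 -colE.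
  move/(congr1 (fun M : 'cV_(g + g) => M i 0)); rewrite [LHS]mxE => ->.
  by rewrite -[i]splitK; case: (split i) => i' /=;
    rewrite ?col_mxEu ?col_mxEd !mxE ?andbT.
have EA : A = block_mx 1%:M (usubmx (rsubmx A)) 0 (dsubmx (rsubmx A)).
  by rewrite -{1}[A]hsubmxK E -{1}[rsubmx A]vsubmxK block_mxEh.
have A1 : ulsubmx A = 1%:M by rewrite EA block_mxKul.
have A2 : dlsubmx A = 0 by rewrite EA block_mxKdl.
move: xJ; rewrite -[A]submxK {EA} A1 A2 /Eup_mx block_mxKur.
move: (ursubmx A) (drsubmx A) => q D.
rewrite tr_block_mx /Jmx !mulmx_block !trmx1 !trmx0.
rewrite !(mulmxN, mulNmx, mul0mx, mulmx0, mul1mx, mulmx1, addr0, add0r, oppr0).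
case/eq_block_mx => _ /oppr_inj -> _; rewrite trmx1 mul1mx mulmx1.
by move/eqP; rewrite subr_eq0 => /eqP <-.
Qed.

Lemma stabLd_mx (x : stabLd k g) :
  val (val x) = Elow_mx (low_form x) /\ (low_form x)^T = low_form x.
Proof.
have xJ := Sp_mulJ (val x); have /asboolP fx := valP x.
rewrite /low_form; move: (val (val x)) xJ fx => A xJ fx.
have E : rsubmx A = col_mx 0 1%:M.
  apply/matrixP => i j; have := fx (delta_mx j 0).
  rewrite -{1}[A]hsubmxK mul_row_col mulmx0 add0r -colE.
  move/(congr1 (fun M : 'cV_(g + g) => M i 0)); rewrite [LHS]mxE => ->.
  by rewrite -[i]splitK; case: (split i) => i' /=;
    rewrite ?col_mxEu ?col_mxEd !mxE ?andbT.
have EA : A = block_mx (usubmx (lsubmx A)) 0 (dsubmx (lsubmx A)) 1%:M.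
  by rewrite -{1}[A]hsubmxK E -{1}[lsubmx A]vsubmxK block_mxEh.
have A1 : ursubmx A = 0 by rewrite EA block_mxKur.
have A2 : drsubmx A = 1%:M by rewrite EA block_mxKdr.
move: xJ; rewrite -[A]submxK {EA} A1 A2 /Elow_mx block_mxKdl.
move: (dlsubmx A) (ulsubmx A) => q D.
rewrite tr_block_mx /Jmx !mulmx_block !trmx1 !trmx0.
rewrite !(mulmxN, mulNmx, mul0mx, mulmx0, mul1mx, mulmx1, addr0, add0r, oppr0).
case/eq_block_mx => h _ D1 _; move: h; rewrite D1 trmx1 mul1mx mulmx1.
by move/eqP; rewrite subr_eq0 => /eqP.
Qed.

Lemma up_formM x y : up_form (x * y)%g = up_form x + up_form y.
Proof.
rewrite {1}/up_form [val (val _)](_ : _ = val (val x) *m val (val y)) //.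
have [-> _] := stabL_mx x; have [-> _] := stabL_mx y.
by rewrite mulmx_block block_mxKur mul1mx mulmx1 addrC.
Qed.

Lemma low_formM x y : low_form (x * y)%g = low_form x + low_form y.
Proof.
rewrite {1}/low_form [val (val _)](_ : _ = val (val x) *m val (val y)) //.
have [-> _] := stabLd_mx x; have [-> _] := stabLd_mx y.
by rewrite mulmx_block block_mxKdl mul1mx mulmx1.
Qed.

Lemma up_form1 : up_form 1%g = 0.
Proof. by apply: (addIr (up_form 1%g)); rewrite -up_formM mulg1 add0r. Qed.

Lemma low_form1 : low_form 1%g = 0.
Proof. by apply: (addIr (low_form 1%g)); rewrite -low_formM mulg1 add0r. Qed.

Notation word := (fpword (stabL k g) (stabLd k g)).

(** The signs (-1)^j of the Sylvester matrix become a sign on the letters of the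
    stabilizer of L.  The zero block in front plays the role of the letter that
    keeps the parity of the sequence. *)
Definition strip_letter (a : stabL k g + stabLd k g) (s : strip) : strip :=
  match a with
  | inl x => prepend 0 (prepend (- up_form x) s)
  | inr y => retouch (low_form y) s
  end.

Definition strip_of (w : word) : strip := foldr strip_letter strip0 w.

Lemma strip_letter_wf a s : strip_wf s -> strip_wf (strip_letter a s).
Proof.
case: a => x sw /=; last by apply: retouch_wf => //; case: (stabLd_mx x).
apply: prepend_wf; rewrite ?trmx0 //; apply: prepend_wf => //.
by have [_ xT] := stabL_mx x; rewrite linearN /= xT.
Qed.

Lemma strip_of_wf w : strip_wf (strip_of w).
Proof. by elim: w => [|a w IHw]; [apply: strip0_wf | apply: strip_letter_wf]. Qed.

Lemma sreduces_letter a s t :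
  sreduces s t -> sreduces (strip_letter a s) (strip_letter a t).
Proof.
case: a => x st /=; last exact: reduces_retouch.
by do 2!apply: reduces_prepend.
Qed.

Lemma sreduces_foldr w s t :
  sreduces s t -> sreduces (foldr strip_letter s w) (foldr strip_letter t w).
Proof. by move=> st; elim: w => [//|a w IHw]; apply: sreduces_letter. Qed.

Lemma prependD s a y : prepend (a + y) s = retouch y (prepend a s).
Proof. by rewrite /prepend /retouch /= prepend_formD. Qed.

(** The identity by which adjacent letters of one factor of the free product are
    multiplied: a zero letter between two blocks merges them. *)
Lemma sreduces_merge s a : strip_wf s ->
  sreduces (prepend a (prepend 0 s)) (retouch a s).
Proof.
move=> [sT dd]; have := reduces_retouch a (reduces_prepend00 sT dd).
by rewrite -prepend_formD add0r.
Qed.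

(** Neutral and adjacent letters of the stabilizer of L are the case of blocks
    separated by a zero block; those of the stabilizer of L^* only add up in
    the first diagonal block. *)
Lemma fpstep_sreduces (u v : word) : fpstep u v -> sreduces (strip_of u) (strip_of v).
Proof.
case=> [s t|s t|s t a b|s t a b]; rewrite /strip_of !foldr_cat.
- apply: sreduces_foldr; rewrite /= up_form1 oppr0.
  by have [sT dd] := strip_of_wf t; apply: reduces_prepend00.
- rewrite /= low_form1 /retouch /retouch_form mulmx0 mul0mx addr0.
  by apply: sreduces_foldr; apply: reduces_refl.
- apply: sreduces_foldr => /=; rewrite up_formM opprD.
  apply: reduces_prepend; rewrite addrC prependD; apply: sreduces_merge.
  apply: prepend_wf; last exact: strip_of_wf.
  by have [_ xT] := stabL_mx b; rewrite linearN /= xT.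
rewrite /= low_formM /retouch /retouch_form /= -addrA -mulmxDl -mulmxDr
  [low_form b + _]addrC.
exact/sreduces_foldr/reduces_refl.
Qed.

Definition strip_class (w : word) : witt k := form_class (sform (strip_of w)).

Lemma strip_class_equiv u v : fpequiv u v -> strip_class u = strip_class v.
Proof.
elim=> {u v} [u v /fpstep_sreduces|//|//|u v w _ -> _ ->//].
by apply: form_class_reduces; case: (strip_of_wf u).
Qed.

End Strips.

(** * Sylvester matrices and strips *)

Section Sylvester.
Variables (k : fieldType) (g : nat).

Notation word := (fpword (stabL k g) (stabLd k g)).

(** The Sylvester matrix with its alternating signs moved into the blocks, so
    that removing the first block gives a matrix of the same kind. *)
Definition tridiag l (a : nat -> 'M[k]_g) : 'M[k]_(\sum_(i < l) g) :=
  \mxblock_(i < l, j < l)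
    if i == j then a i else if (i.+1 == j :> nat) || (j.+1 == i :> nat) then 1%:M else
      0.

Definition first_block l : 'M[k]_(\sum_(i < l) g, g) :=
  \mxcol_(i < l) (if i == 0%N :> nat then 1%:M else 0 : 'M[k]_g).

Lemma eq_tridiag l a b : a =1 b -> tridiag l a = tridiag l b.
Proof. by move=> ab; apply: eq_mxblock => i j; rewrite ab. Qed.

Lemma reduces_cast m n (e : m = n) (S : 'M[k]_m) (d : 'M[k]_(m, g)) :
  reduces (castmx (e, e) S) (castmx (e, erefl g) d) S d.
Proof. by case: n / e; rewrite !castmx_id; apply: reduces_refl. Qed.

Lemma tridiag_rec l a :
  reduces (tridiag l.+1 a) (first_block l.+1)
    (prepend_form (a 0%N) (tridiag l (a \o S)) (first_block l)) (first_inc _).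
Proof.
rewrite /tridiag mxblock_recul /first_block mxcol_recu /=.
set S1 := block_mx _ _ _ _; set d1 := col_mx _ _.
suff [-> ->] : prepend_form (a 0%N) (tridiag l (a \o S)) (first_block l) = S1 /\
  first_inc _ = d1.
  exact: reduces_cast.
split; last first.
  by rewrite /first_inc /d1; congr col_mx; rewrite -[LHS]mxcol0; apply/eq_mxcol.
rewrite /S1 /prepend_form; congr block_mx.
  rewrite tr_mxcol; apply: eq_mxrow => j /=.
  by case: j => -[|j] h //=; rewrite ?trmx1 ?trmx0.
by apply: eq_mxcol => j /=; case: j => -[|j] h.
Qed.

Lemma up_form_Eup (q : symmx k g) : up_form (Eup q) = val q.
Proof. by rewrite /up_form /= /Eup_mx block_mxKur. Qed.

Lemma low_form_Elow (q : symmx k g) : low_form (Elow q) = val q.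
Proof. by rewrite /low_form /= /Elow_mx block_mxKdl. Qed.

Lemma low_form_inj : injective (@low_form k g).
Proof.
move=> x y xy; apply/val_inj/val_inj.
by have [-> _] := stabLd_mx x; have [-> _] := stabLd_mx y; rewrite xy.
Qed.

Lemma up_form_inj : injective (@up_form k g).
Proof.
move=> x y xy; apply/val_inj/val_inj.
by have [-> _] := stabL_mx x; have [-> _] := stabL_mx y; rewrite xy.
Qed.

(** The word of a Sturm sequence of type 00 with 2 l + 1 letters starting at an
    even index. *)
Fixpoint word_of l (q : nat -> symmx k g) : word :=
  if l is l'.+1 then inr (Elow (q 0)) :: inl (Eup (q 1)) :: word_of l' (fun i => q i.+2)
  else [:: inr (Elow (q 0))].

Definition signed (q : nat -> symmx k g) (i : nat) : 'M[k]_g := (-1) ^+ i *: val (q i).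

Lemma tridiag_strip l q :
  reduces (tridiag l.*2.+1 (signed q)) (first_block l.*2.+1)
    (sform (strip_of (word_of l q))) (sfirst (strip_of (word_of l q))).
Proof.
elim: l q => [|l IHl] q.
  apply: reduces_trans (tridiag_rec _ _) _.
  rewrite /= low_form_Elow /retouch_form add0r mul1mx trmx1 mulmx1 /signed expr0
    scale1r.
  set S0 := tridiag 0 _; set d0 := first_block 0; move: S0 d0.
  rewrite big_ord0 => S0 d0.
  (* the remaining block column has width 0 and is dropped *)
  have PQ : first_inc 0 *m (row_mx 1%:M 0 : 'M[k]_(g, g + 0)) = 1%:M.
    rewrite /first_inc mul_col_row; mx01_simpl.
    by rewrite [RHS]scalar_mx_block; congr block_mx; apply/matrixP => -[].
  have := iso_reduces (prepend_form (val (q 0)) S0 d0) (first_inc 0) PQ.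
  rewrite /first_inc tr_col_mx mul_row_block !mul_row_col trmx0 trmx1.
  by rewrite !(mul0mx, mulmx0, mul1mx, mulmx1, addr0).
have E : tridiag l.*2.+1 (signed q \o S \o S) = tridiag l.*2.+1
  (signed (fun i => q i.+2)).
  by apply: eq_tridiag => i /=; rewrite /signed !exprS !mulN1r opprK.
have -> : strip_of (word_of l.+1 q) = prepend (val (q 0))
    (prepend (- val (q 1)) (strip_of (word_of l (fun i => q i.+2)))).
  by rewrite /= low_form_Elow up_form_Eup -prependD add0r.
apply: reduces_trans (tridiag_rec _ _) _.
rewrite {1}/signed expr0 scale1r; apply: reduces_prepend.
apply: reduces_trans (tridiag_rec _ _) _.
by rewrite E /= {1}/signed expr1 scaleN1r; apply: reduces_prepend.
Qed.

Lemma evenzD j (n : nat) : evenz j -> evenz (j + n%:Z) = ~~ odd n.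
Proof. by move=> jE; rewrite /evenz rpredDl // -[_ \in _]/(2 %| n%:Z)%Z dvdzE dvdn2.
  Qed.

Lemma sign_evenz j (n : nat) : evenz j -> (-1 : k) ^ (j + n%:Z) = (-1) ^+ n.
Proof.
case/dvdzP => h ->; rewrite expfzDr ?oppr_eq0 ?oner_eq0 // [h * 2]mulrC -exprz_exp.
by rewrite -[(-1) ^ 2]/((-1) ^+ 2) sqrrN expr1n exp1rz mul1r.
Qed.

Notation pi := (fun w : word => (\pi_(SLSLd k g) w : SLSLd k g)).

Lemma pi_cat (u v : word) : pi (u ++ v) = (pi u * pi v)%g.
Proof. exact: pi_fpmul. Qed.

Lemma sturm_word_pi m l (q : nat -> symmx k g) : evenz m ->
  sturm_word (@Sturm k g m l.*2 (fun i => q i)) = \pi_(SLSLd k g) (word_of l q).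
Proof.
move=> mE; rewrite /sturm_word /=.
elim: l m q mE => [|l IHl] m q mE.
  by rewrite big_ord1 /letter evenzD.
rewrite doubleS big_ord_recl big_ord_recl /= {1 2}/letter !evenzD //=.
rewrite (eq_bigr (fun i : 'I_l.*2.+1 => letter (m + i%:Z) (q i.+2))); last first.
  by move=> i _; rewrite /letter !evenzD //= negbK.
rewrite (IHl m (fun i => q i.+2) mE).
by rewrite -(pi_cat [:: inl _]) -(pi_cat [:: inr _]).
Qed.

Lemma sylvester_tridiag m l (q : nat -> symmx k g) : evenz m ->
  val (sylvester (@Sturm k g m l (fun i => q i))) = tridiag l.+1 (signed q).
Proof.
move=> mE; apply: eq_mxblock => i j; case: eqP => // ij.
by rewrite /signed sign_evenz.
Qed.

Lemma type00_even (s : sturm k g) : type00 s ->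
  exists m l (q : nat -> symmx k g), evenz m /\ s = @Sturm k g m l.*2 (fun i => q i).
Proof.
case: s => m l q [/= mE]; rewrite evenzD // => lE.
have [l0 el] : exists l0, l = l0.*2 by exists l./2;
  rewrite -[LHS]odd_double_half (negPf lE).
subst l; exists m, l0, (fun i => q (inord i)); split=> //; congr Sturm.
by apply/funext => i; rewrite inord_val.
Qed.

(** Zero letters are inserted between letters of the same factor and at the
    ends, so every word is represented by a sequence of type 00. *)
Lemma word_normal_form (w : word) :
  exists l q, \pi_(SLSLd k g) w = \pi_(SLSLd k g) (word_of l q).
Proof.
have mkq (A : 'M[k]_g) : A^T = A -> exists q : symmx k g, val q = A.
  by move=> /eqP AT; exists (exist (fun A => is_true (A^T == A)) A AT).
elim: w => [|a w [l [q E]]].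
  have [z z0] := mkq 0 (trmx0 _ _ _); exists 0%N, (fun=> z); apply/fp_eq/FPSym.
  have Ez : Elow z = 1%g by apply: low_form_inj; rewrite low_form_Elow low_form1.
  rewrite /= Ez; exact/FPStep/(FPOneR [::]).
have -> : \pi_(SLSLd k g) (a :: w) = \pi_(SLSLd k g) (a :: word_of l q).
  by rewrite -cat1s -[a :: word_of _ _]cat1s !pi_fpmul E.
case: a => x.
  have [_ /mkq[q1 q1x]] := stabL_mx x; have [z z0] := mkq 0 (trmx0 _ _ _).
  exists l.+1, (fun i => if i is i'.+1 then if i' is i''.+1 then q i'' else q1 else z).
  have -> : x = Eup q1 by apply: up_form_inj; rewrite up_form_Eup.
  have Ez : Elow z = 1%g by apply: low_form_inj; rewrite low_form_Elow low_form1.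
  rewrite /= Ez.
  exact/fp_eq/FPSym/FPStep/(FPOneR [::]).
have [_ xT] := stabLd_mx x.
have [|q0 q0x] := mkq (low_form x + val (q 0%N)).
  by rewrite linearD /= xT symmxP.
exists l, (fun i => if i is i'.+1 then q i else q0).
have Eq : Elow q0 = (x * Elow (q 0%N))%g.
  by apply: low_form_inj; rewrite low_formM !low_form_Elow.
case: l {E} => [|l]; rewrite /= Eq;
  exact/fp_eq/FPStep/(FPMulR [::]).
Qed.

(** Every representative of type 00 has the form [word_of], and the class of its
    strip is an invariant of the element of the free product. *)
Lemma f00_pi (w : word) : f00 (pi w) = strip_class w.
Proof.
have value m l (q : nat -> symmx k g) : evenz m ->
    witt_class (sylvester (@Sturm k g m l.*2 (fun i => q i))) = strip_class
      (word_of l q).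
  move=> mE; rewrite -form_classE sylvester_tridiag //.
  by apply: (@form_class_reduces _ g) (tridiag_strip l q);
    rewrite -(sylvester_tridiag _ q mE) symmxP.
apply: xget_unique => [|c [s [/type00_even[m [l [q [mE ->]]]]]]]; last first.
  rewrite sturm_word_pi // => E ->; rewrite value //; apply: strip_class_equiv.
  by move/eqP: E; rewrite piE => /asboolP.
have [l [q E]] := word_normal_form w; exists (@Sturm k g 0 l.*2 (fun i => q i)).
have e0 : evenz 0 by [].
split; [by split; rewrite //= evenzD // odd_double|by rewrite sturm_word_pi|].
rewrite value //; apply: strip_class_equiv.
by move/eqP: E; rewrite piE => /asboolP.
Qed.

End Sylvester.

(** * Transfer of solutions and gluing *)

Section Transfer.
Variables (k : fieldType) (g : nat).

Notation word := (fpword (stabL k g) (stabLd k g)).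
Notation pi := (fun w : word => (\pi_(SLSLd k g) w : SLSLd k g)).

Definition eval_mx (w : word) : 'M[k]_(g + g) := val (Eval (pi w)).

Lemma eval_mx_nil : eval_mx [::] = 1%:M.
Proof.
have E : pi [::] = 1%g by rewrite -[1%g]/(fp1 _ _) piE.
by rewrite /eval_mx E gmulf1.
Qed.

Lemma eval_mx_inl x w : eval_mx (inl x :: w) = Eup_mx (up_form x) *m eval_mx w.
Proof.
rewrite /eval_mx (pi_cat [:: inl x] w) gmulfM Sp_valM; congr (_ *m _).
have [<- _] := stabL_mx x; congr val.
by apply: etrans (pi_fpeval _ _ _) _; rewrite /fpword_eval big_seq1.
Qed.

Lemma eval_mx_inr y w : eval_mx (inr y :: w) = Elow_mx (low_form y) *m eval_mx w.
Proof.
rewrite /eval_mx (pi_cat [:: inr y] w) gmulfM Sp_valM; congr (_ *m _).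
have [<- _] := stabLd_mx y; congr val.
by apply: etrans (pi_fpeval _ _ _) _; rewrite /fpword_eval big_seq1.
Qed.

Definition is_inl (a : stabL k g + stabLd k g) := if a is inl _ then true else false.
Definition odd_letters (w : word) : nat := count is_inl w.

(** X is a family of g vectors with last coordinate 1 that is orthogonal to
    every block but the first: a solution of the linear recursion given by the
    rows of S, with first coordinate Z and defect Y in the first row. *)
Definition solution (s : strip k g) (Z Y : 'M[k]_g) (X : 'M[k]_(sdim s, g)) : Prop :=
  [/\ sform s *m X = sfirst s *m Y, (sfirst s)^T *m X = Z & (slast s)^T *m X = 1%:M].

Arguments solution : clear implicits.

Lemma solution_prepend a s Z Y X :
  solution s Z Y X -> solution (prepend a s) (- Y) (Z - a *m Y) (col_mx (- Y) X).
Proof.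
case=> sX fX lX; split.
- rewrite /= /prepend_form /first_inc mul_block_col mul_col_mx sX fX mulmxN mulmxN
  addrC.
  by rewrite mul1mx mul0mx addrC addNr addrC.
- by rewrite /= tr_col_mx mul_row_col trmx1 trmx0 mul1mx mul0mx addr0.
by rewrite /= tr_col_mx mul_row_col trmx0 mul0mx add0r.
Qed.

Lemma solution_retouch y s Z Y X :
  solution s Z Y X -> solution (retouch y s) Z (Y + y *m Z) X.
Proof.
by case=> sX fX lX; split=> //=; rewrite mulmxDl -!mulmxA fX sX -mulmxDr.
Qed.

(** Prepending a letter acts on the pair (Z, Y) by the corresponding elementary
    symplectic matrix, up to a sign for each letter of the stabilizer of L. *)
Lemma strip_solution w : exists X : 'M[k]_(sdim (strip_of w), g),
  solution (strip_of w) ((-1) ^+ odd_letters w *: ulsubmx (eval_mx w))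
    ((-1) ^+ odd_letters w *: dlsubmx (eval_mx w)) X.
Proof.
elim: w => [|[x|y] w [X sol]].
- exists 1%:M; rewrite eval_mx_nil /= expr0 !scale1r [1%:M]scalar_mx_block.
  by rewrite block_mxKul block_mxKdl; split; rewrite /= ?trmx1 ?mulmx1 ?mulmx0.
- rewrite eval_mx_inl -[eval_mx w]submxK in sol *;
  rewrite block_mxKul block_mxKdl in sol.
  rewrite /Eup_mx mulmx_block block_mxKul block_mxKdl; mx01_simpl.
  eexists; have := solution_prepend 0 (solution_prepend (- up_form x) sol).
  rewrite mul0mx subr0 -[odd_letters (inl x :: w)]/(odd_letters w).+1 exprS -!scalerA
    !scaleN1r.
  rewrite mulNmx opprK -scalemxAr -scalerDr => h; exact: h.
rewrite eval_mx_inr -[eval_mx w]submxK in sol *; rewrite block_mxKul block_mxKdl in sol.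
exists X; have := solution_retouch (low_form y) sol.
rewrite /Elow_mx mulmx_block block_mxKul block_mxKdl; mx01_simpl.
by rewrite -scalemxAr -scalerDr addrC.
Qed.

(** W is the restriction of the orthogonal sum of U and V to the subspace where
    the last coordinates of U equal the first coordinates of V; the pair
    (T1, T2) is the inclusion, and the last clause says that it reaches the
    whole subspace. *)
Definition glued (U V W : strip k g) : Prop :=
  exists (T1 : 'M[k]_(sdim U, sdim W)) (T2 : 'M[k]_(sdim V, sdim W)),
    [/\ sform W = T1^T *m sform U *m T1 + T2^T *m sform V *m T2,
        sfirst W = T1^T *m sfirst U &
        forall p (x : 'M_(sdim U, p)) (y : 'M_(sdim V, p)),
          (slast U)^T *m x = (sfirst V)^T *m y ->
          exists Q, T1 *m Q = x /\ T2 *m Q = y].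

Lemma glued_prepend a U V W : glued U V W -> glued (prepend a U) V (prepend a W).
Proof.
case=> T1 [T2 [E F G]]; exists (block_mx 1%:M 0 0 T1), (row_mx 0 T2); split.
- rewrite /= /prepend_form tr_block_mx tr_row_mx !mulmx_block mul_col_mx mul_col_row.
  by rewrite E F add_block_mx trmx_mul trmxK; mx01_simpl.
- by rewrite /= /first_inc tr_block_mx mul_block_col; mx01_simpl.
move=> p x y; rewrite -[x]vsubmxK /= tr_col_mx mul_row_col trmx0 mul0mx add0r.
move=> /G[Q [Qx Qy]]; exists (col_mx (usubmx x) Q).
by rewrite mul_block_col mul_row_col; mx01_simpl; rewrite Qx Qy.
Qed.

Lemma glued_retouch y U V W : glued U V W -> glued (retouch y U) V (retouch y W).
Proof.
case=> T1 [T2 [E F G]]; exists T1, T2; split=> //=.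
by rewrite /retouch_form E F mulmxDr mulmxDl trmx_mul trmxK !mulmxA addrAC.
Qed.

(** In a product uv the last letter of u and the first letter of v share one
    diagonal block, in which they are added. *)
Lemma strip_glue (u v : word) : glued (strip_of u) (strip_of v) (strip_of (u ++ v)).
Proof.
elim: u => [|[x|y] u IHu] /=.
- exists (sfirst (strip_of v))^T, 1%:M; split.
  + by rewrite /= mulmx0 mul0mx add0r trmx1 mul1mx mulmx1.
  + by rewrite /= trmxK mulmx1.
  move=> p x y; rewrite /= trmx1 mul1mx => ->; exists y; split=> //.
  exact: mul1mx.
- by do 2!apply: glued_prepend.
exact: glued_retouch.
Qed.

Lemma radical_shift m n r (S : 'M[k]_m) (X : 'M_(m, r)) (x : 'M_(m, n))
  (M : 'M_(r, n)) :
  S^T = S -> S *m X = 0 ->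
  (x + X *m M)^T *m S *m (x + X *m M) = x^T *m S *m x.
Proof.
move=> ST SX; have XS : X^T *m S = 0 by rewrite -[LHS]trmxK trmx_mul trmxK ST SX trmx0.
rewrite [(x + _)^T]linearD /= trmx_mul mulmxDl -(mulmxA _ X^T) XS mulmx0 addr0.
by rewrite mulmxDr [_ *m (X *m M)]mulmxA -[_ *m S *m X]mulmxA SX mulmx0 mul0mx addr0.
Qed.

(** The pair (x, y) is a form preserving map from the full orthogonal sum into
    the glued subspace; together with the inclusion it makes the two forms
    represent each other. *)
Lemma glue_split (u v : word) (U := strip_of u) (V := strip_of v)
    (x : 'M[k]_(sdim U, sdim U + sdim V)) (y : 'M[k]_(sdim V, sdim U + sdim V)) :
  (slast U)^T *m x = (sfirst V)^T *m y ->
  x^T *m sform U *m x + y^T *m sform V *m y = osum (sform U) (sform V) ->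
  strip_class (u ++ v) = strip_class u + strip_class v.
Proof.
have [wU _] := strip_of_wf u; have [wV _] := strip_of_wf v.
have [wW _] := strip_of_wf (u ++ v).
have [T1 [T2 [E _ G]]] := strip_glue u v; move=> /G[Q [Qx Qy]] xy.
rewrite /strip_class -form_class_osum //; apply: form_class_mutual => //; split.
  exists Q; rewrite E -xy; rewrite -Qx -Qy mulmxDr mulmxDl !trmx_mul !mulmxA //.
exists (col_mx T1 T2).
by rewrite tr_col_mx /osum mul_row_block mul_row_col !mulmx0 addr0 add0r E.
Qed.

Lemma osum_proj m n (A : 'M[k]_m) (B : 'M[k]_n) :
  (row_mx 1%:M 0)^T *m A *m row_mx 1%:M 0 + (row_mx 0 1%:M)^T *m B *m row_mx 0 1%:M
  = osum A B.
Proof.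
rewrite !tr_row_mx (mul_col_mx _ _ A) (mul_col_mx _ _ B) !mul_col_row add_block_mx
  /osum.
by rewrite !(trmx1, trmx0, mul0mx, mulmx0, mul1mx, mulmx1, addr0, add0r).
Qed.

(** The mismatch between the end coordinates of the two forms is corrected by
    the radical vectors X of the relation n, whose last coordinate is 1. *)
Lemma strip_class_kerl (n w : word) :
  eval_mx n = 1%:M -> strip_class (n ++ w) = strip_class n + strip_class w.
Proof.
move=> n1; have [X [SX _ lX]] := strip_solution n.
move: SX; rewrite n1 [1%:M]scalar_mx_block block_mxKdl scaler0 mulmx0 => SX.
have [ST _] := strip_of_wf n.
pose p1 : 'M[k]_(_, sdim (strip_of n) + sdim (strip_of w)) := row_mx 1%:M 0.
pose p2 : 'M[k]_(_, sdim (strip_of n) + sdim (strip_of w)) := row_mx 0 1%:M.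
apply: (@glue_split _ _ (p1 + X *m ((sfirst (strip_of w))^T *m p2 -
  (slast (strip_of n))^T *m p1)) p2).
  by rewrite [LHS]mulmxDr [_ *m (X *m _)]mulmxA lX mul1mx addrC subrK.
by rewrite radical_shift // osum_proj.
Qed.

(** As in [strip_class_kerl], with the first coordinate of X, which is a sign. *)
Lemma strip_class_kerr (n w : word) :
  eval_mx n = 1%:M -> strip_class (w ++ n) = strip_class w + strip_class n.
Proof.
move=> n1; have [X [SX fX _]] := strip_solution n.
move: SX fX; rewrite n1 [1%:M]scalar_mx_block block_mxKdl block_mxKul scaler0 mulmx0
  => SX fX.
have [ST _] := strip_of_wf n.
pose p1 : 'M[k]_(_, sdim (strip_of w) + sdim (strip_of n)) := row_mx 1%:M 0.
pose p2 : 'M[k]_(_, sdim (strip_of w) + sdim (strip_of n)) := row_mx 0 1%:M.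
pose e : k := (-1) ^+ odd_letters n.
apply: (@glue_split _ _ p1 (p2 + X *m (e *:
  ((slast (strip_of w))^T *m p1 - (sfirst (strip_of n))^T *m p2)))).
  rewrite [RHS]mulmxDr [_ *m (X *m _)]mulmxA fX -scalemxAl mul1mx scalerA -expr2
    sqrr_sign scale1r.
  by rewrite addrC subrK.
by rewrite radical_shift // osum_proj.
Qed.

End Transfer.

(** * Classes modulo the square of the fundamental ideal *)

Lemma mutual_congr (k : fieldType) n (A P : 'M[k]_n) :
  P \in unitmx -> mutual A (P^T *m A *m P).
Proof.
move=> uP; split; first by exists P.
exists (invmx P); rewrite !mulmxA -trmx_mul mulmxV // trmx1 mul1mx -mulmxA.
by rewrite mulmxV ?mulmx1.
Qed.

Section ModI2.
Variable k : fieldType.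
Hypothesis k2 : 2%N \notin [pchar k].

Lemma modI2D a b : modI2 (a + b : witt k) = modI2 a + modI2 b.
Proof. exact: raddfD. Qed.

Lemma modI2N a : modI2 (- a : witt k) = - modI2 a.
Proof. exact: raddfN. Qed.

Lemma modI2M a b : modI2 (a * b : witt k) = modI2 a * modI2 b.
Proof. exact: rmorphM. Qed.

Lemma modI2_1 : modI2 (1 : witt k) = 1.
Proof. exact: rmorph1. Qed.

Lemma modI2_eq0 (a : witt k) : a \in @fundI2 k -> modI2 a = 0.
Proof.
move=> aI; rewrite /modI2; apply/eqP; rewrite -(raddf0 \pi_(witt_I2 k)).
by rewrite -Quotient.idealrBE subr0.
Qed.

Lemma modI2_fundIM (a b : witt k) : a \in @fundI k -> b \in @fundI k ->
  modI2 (a * b) = 0.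
Proof.
move=> aI bI; apply: modI2_eq0; apply/asboolP.
by exists 1%N, (fun=> a), (fun=> b); split=> //; rewrite big_ord1.
Qed.

Lemma witt_I2_4 : 4%:R = 0 :> witt_I2 k.
Proof.
have I2 : (1 + 1 : witt k) \in @fundI k.
  by rewrite unfold_in rmorphD rmorph1 addF2.
rewrite -[4%N]/(2 * 2)%N natrM.
have <- : modI2 (1 + 1 : witt k) = 2%:R by rewrite modI2D modI2_1.
by rewrite -modI2M modI2_fundIM.
Qed.

Lemma witt_I2_mul4 (a : witt_I2 k) : a *+ 4 = 0.
Proof. by rewrite -mulr_natr witt_I2_4 mulr0. Qed.

Definition rank1 (a : k) : witt k := form_class (a%:M : 'M_1).

Lemma rank1_proof (a : k) : a != 0 -> (a%:M : 'M_1)^T = a%:M /\ (a%:M : 'M_1) \in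
  unitmx.
Proof.
by move=> a0; rewrite tr_scalar_mx unitmxE det_scalar1 unitfE.
Qed.

Lemma rank1_pi a (a0 : a != 0) : rank1 a = \pi_(witt k) (mk_ispace (rank1_proof a0)).
Proof. exact/form_class_pi/mutual_refl. Qed.

Lemma rank1M a b : a != 0 -> b != 0 -> rank1 (a * b) = rank1 a * rank1 b.
Proof.
move=> a0 b0; rewrite (rank1_pi a0) (rank1_pi b0) -[RHS]/(wittM _ _) !piE.
apply/form_class_pi/iso_mutual; rewrite /= /gram /=.
have -> : (a%:M : 'M_1) *t (b%:M : 'M_1) = (a * b)%:M.
  apply/matrixP => i j; case: (mxtens_indexP i) => i1 i2; case: (mxtens_indexP j) =>
    j1 j2.
  by rewrite tensmxE ![in LHS]ord1 !mxE !mulr1n !ord1 eqxx mulr1n.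
exact: iso_refl.
Qed.

Lemma rank1_1 : rank1 1 = 1.
Proof.
rewrite (rank1_pi (oner_neq0 _)) -[1 in RHS]/(witt1 k) piE; apply/witt_eq/iso_witt.
exact: iso_refl.
Qed.

Lemma rank1N1 : rank1 (-1) = -1.
Proof.
apply/eqP; rewrite -addr_eq0 -rank1_1 addrC -form_class_osum ?tr_scalar_mx //.
rewrite raddfN form_class_metabolic //; first last.
- exact: metabolicN.
- by rewrite unitmxE det_ublock unitrM -!unitmxE unitmx1 -scaleN1r unitmxZ ?unitrN1
  ?unitmx1.
by rewrite tr_block_mx !trmx0 linearN /= !trmx1.
Qed.

Lemma rank1_sqr a c : c != 0 -> rank1 (a * c ^+ 2) = rank1 a.
Proof.
move=> c0; apply: form_class_mutual; first by rewrite tr_scalar_mx.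
have E (b h : k) : (h%:M)^T *m b%:M *m h%:M = (b * h ^+ 2)%:M :> 'M_1.
  by rewrite tr_scalar_mx -!scalar_mxM mulrAC -expr2 mulrC.
split; first by exists (c^-1)%:M; rewrite E exprVn mulfK ?expf_neq0.
by exists c%:M; rewrite E.
Qed.

Lemma rank1_fundI a : a != 0 -> rank1 a - 1 \in @fundI k.
Proof.
move=> a0; rewrite unfold_in rmorphB rmorph1 (rank1_pi a0) /=.
by rewrite piE subrr.
Qed.

(** Expand (<a> - 1)(<b> - 1), a product of two elements of I. *)
Lemma modI2_rank1M a b : a != 0 -> b != 0 ->
  modI2 (rank1 (a * b)) = modI2 (rank1 a) + modI2 (rank1 b) - 1.
Proof.
move=> a0 b0; apply/eqP; rewrite -subr_eq0 -modI2_1 -modI2D -!modI2N -!modI2D -!modI2N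
  -!modI2D.
rewrite -(modI2_fundIM (rank1_fundI a0) (rank1_fundI b0)) rank1M //; apply/eqP;
  congr modI2.
ring.
Qed.

(** Otherwise polarization gives 2 A = 0. *)
Lemma anisotropic_vector n (A : 'M[k]_n.+1) : A^T = A -> A \in unitmx ->
  exists v : 'rV_n.+1, (v *m A *m v^T) 0 0 != 0.
Proof.
move=> AT uA; apply: contrapT => /forallNP h.
pose f (u v : 'rV_n.+1) := (u *m A *m v^T) 0 0.
have {}h v : f v v = 0 by apply/eqP/negPn/negP; apply: h.
have fDl u v w : f (u + v) w = f u w + f v w by rewrite /f !mulmxDl mxE.
have fDr u v w : f u (v + w) = f u v + f u w.
  by rewrite /f [(v + w)^T]linearD /= mulmxDr mxE.
have fE i j : f (delta_mx 0 i) (delta_mx 0 j) = A i j.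
  by rewrite /f trmx_delta -rowE -colE !mxE.
have A0 : A = 0.
  apply/matrixP => i j; rewrite [RHS]mxE.
  have := h (delta_mx 0 i + delta_mx 0 j); rewrite fDl !fDr !h add0r addr0 !fE.
  have -> : A j i = A i j by rewrite -[in LHS]AT mxE.
  move/eqP; rewrite -mulr2n -mulr_natl mulf_eq0 => /orP[two|/eqP//].
  by move: k2; rewrite inE /= two.
by move: uA; rewrite A0 unitmxE det0 unitr0.
Qed.

(** Split off the line of an anisotropic vector and use [modI2_rank1M] to
    collect the determinants. *)
Lemma modI2_disc n (A : 'M[k]_n) : A^T = A -> A \in unitmx ->
  modI2 (form_class A) = modI2 (rank1 (\det A)) + n%:R - 1.
Proof.
elim: n A => [|n IHn] A AT uA.
  by rewrite form_class_empty det_mx00 rank1_1 modI2_1 addr0 subrr; apply: raddf0.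
have [v v0] := anisotropic_vector AT uA.
pose P := (row_ebase v)^T; have uP : P \in unitmx by rewrite unitmx_tr row_ebase_unit.
pose B : 'M_(1 + n) := P^T *m A *m P.
have BT : B^T = B by rewrite /B !trmx_mul trmxK AT mulmxA.
have AB : mutual A B by apply: mutual_congr.
have detB : \det B = \det A * \det P ^+ 2.
  by rewrite /B !det_mulmx det_tr mulrC mulrA expr2 mulrC.
have v_neq0 : v != 0 by apply: contraNneq v0 => ->; rewrite !mul0mx mxE.
have rv : \rank v = 1%N.
  by apply/eqP; rewrite eqn_leq rank_leq_row lt0n mxrank_eq0.
(* v has rank 1, so the first row of the invertible matrix row_ebase v is a
   nonzero multiple of v *)
have vE : v = col_ebase v 0 0 *: row 0 (row_ebase v).
  have pidE : pid_mx 1 *m row_ebase v = row 0 (row_ebase v) :> 'rV_n.+1.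
    by rewrite rowE; congr (_ *m _); apply/matrixP => i j;
      rewrite !mxE ord1 /= andbT eq_sym.
  by rewrite -{1}[v]mulmx_ebase rv -mulmxA pidE {1}[col_ebase v]mx11_scalar
    mul_scalar_mx.
have a0 : B 0 0 != 0.
  apply: contraNneq v0 => aa0; apply/eqP.
  have -> : v *m A *m v^T = (col_ebase v 0 0) ^+ 2 *:
    (row 0 (P^T) *m A *m (row 0 (P^T))^T).
    rewrite {1 2}vE /P trmxK linearZ /= -!scalemxAl -scalemxAr scalerA expr2 //.
  have B00 : B 0 0 = (row 0 P^T *m A *m (row 0 P^T)^T) 0 0.
    by rewrite tr_row trmxK -!row_mul colE mulmxA -colE [RHS]mxE [RHS]mxE.
  by rewrite [LHS]mxE -B00 aa0 mulr0.
move: B BT AB detB a0 => B BT AB detB a0.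
set a := B 0 0 in a0 *; pose r := dlsubmx B; pose C := drsubmx B.
have EB : B = block_mx a%:M r^T r C.
  rewrite -[LHS]submxK; congr block_mx; last by rewrite trmx_dlsub BT.
  by apply/matrixP => i j; rewrite !ord1 !mxE mulr1n; congr (B _ _); apply: val_inj.
pose C' := C - a^-1 *: (r *m r^T).
have C'T : C'^T = C'.
  by rewrite /C' linearB linearZ /= trmx_mul trmxK trmx_drsub BT.
(* clear the first row and column *)
pose E : 'M[k]_(1 + n) := block_mx 1%:M (- (a^-1 *: r^T)) 0 1%:M.
have EBE : E^T *m B *m E = osum a%:M C'.
  rewrite EB /E tr_block_mx !mulmx_block !(trmx0, trmx1); mx01_simpl.
  have e1 : a%:M *m (a^-1 *: r^T) = r^T by rewrite mul_scalar_mx scalerA divff //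
    scale1r.
  have e2 : (a^-1 *: r^T)^T = a^-1 *: r by rewrite linearZ /= trmxK.
  have e3 : (a^-1 *: r) *m a%:M = r by rewrite mul_mx_scalar scalerA divff // scale1r.
  rewrite mulmxN e1 addNr [(- _)^T]linearN /= e2 !mulNmx e3 addNr mul0mx add0r.
  by rewrite -scalemxAl addrC.
have detE : \det E = 1 by rewrite det_ublock !det1 mulr1.
have detBC : \det B = a * \det C'.
  have := congr1 determinant EBE; rewrite !det_mulmx det_tr detE mul1r mulr1.
  by rewrite det_ublock det_scalar1.
have uE : E \in unitmx by rewrite unitmxE detE unitr1.
have BC : mutual B (osum (a%:M : 'M_1) C').
  by rewrite -EBE; apply: mutual_congr.
have uB : \det B != 0.
  by rewrite -unitfE detB unitrM unitrX -!unitmxE ?uA ?uP.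
have dC : \det C' != 0 by move: uB; rewrite detBC mulf_eq0 negb_or => /andP[].
have uC : C' \in unitmx by rewrite unitmxE unitfE.
rewrite (form_class_mutual AT AB) (form_class_mutual BT BC) form_class_osum
  ?tr_scalar_mx //.
rewrite modI2D (IHn _ C'T uC) -(@rank1_sqr (\det A) (\det P));
  last by rewrite -unitfE -unitmxE.
rewrite -detB detBC modI2_rank1M // -/(rank1 a) [n.+1%:R]mulrS. 
ring.
Qed.

End ModI2.

(** * Relations of the symplectic group have classes in the square *)

Section Kernel.
Variables (k : fieldType) (g : nat).

Notation word := (fpword (stabL k g) (stabLd k g)).

(** The extra unknown absorbs the defect Y of a solution in the first row, and the
    extra equation prescribes the last coordinate.  Up to a sign this matrix has
    determinant 1, which lets det S be compared with det Y. *)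
Definition bordered (s : strip k g) : 'M[k]_(g + sdim s) :=
  block_mx 0 (slast s)^T (sfirst s) (sform s).

(** The matrix exchanges the summand k^g with the image of c; it is a product of
    elementary block matrices and of diag(-1, 1). *)
Lemma det_swap n (r : 'M[k]_(g, n)) (c : 'M[k]_(n, g)) : r *m c = 1%:M ->
  \det (block_mx 0 r c (1%:M - c *m r)) = (-1) ^+ g.
Proof.
move=> rc.
pose L : 'M[k]_(g + n) := block_mx 1%:M 0 c 1%:M.
pose R : 'M[k]_(g + n) := block_mx 1%:M (- r) 0 1%:M.
pose D : 'M[k]_(g + n) := block_mx (- 1%:M) 0 0 1%:M.
have -> : block_mx 0 r c (1%:M - c *m r) = D *m (L *m R *m L).
  rewrite /D /L /R !mulmx_block; mx01_simpl.
  have cr : (c *m - r + 1%:M) *m c = 0 by rewrite mulmxDl mulmxN mulNmx -mulmxA rc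
    mulmx1 mul1mx addNr.
  by rewrite cr [- r *m c]mulNmx rc subrr mulmx0 mulNmx mul1mx opprK addr0 mulmxN addrC.
rewrite !det_mulmx !det_lblock !det_ublock !det1 !mulr1.
by rewrite -scaleN1r detZ det1 mulr1.
Qed.

Lemma det_bordered_prepend a s : \det (bordered (prepend a s)) = (-1) ^+ g * \det
  (bordered s).
Proof.
pose r : 'M[k]_(g, g + sdim s) := row_mx 1%:M 0.
pose c : 'M[k]_(g + sdim s, g) := col_mx 1%:M 0.
have rc : r *m c = 1%:M by rewrite mul_row_col mulmx1 mulmx0 addr0.
have cr : 1%:M - c *m r = block_mx 0 0 0 1%:M.
  rewrite mul_col_row [1%:M]scalar_mx_block opp_block_mx add_block_mx.
  by mx01_simpl; rewrite subrr.
rewrite -(det_swap rc) cr.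
pose F : 'M[k]_(g + (g + sdim s)) := block_mx 1%:M (row_mx a (sfirst s)^T) 0
  (bordered s).
have -> : \det (bordered s) = \det F by rewrite det_ublock det1 mul1r.
rewrite -det_mulmx; congr determinant.
rewrite /F /bordered mulmx_block; mx01_simpl.
rewrite mul_row_block mulmx_block mul_col_row /= /prepend_form /first_inc tr_col_mx
  trmx0.
by rewrite add_block_mx; mx01_simpl.
Qed.

Lemma det_bordered_retouch y s : \det (bordered (retouch y s)) = \det (bordered s).
Proof.
pose F : 'M[k]_(g + sdim s) := block_mx 1%:M (y *m (sfirst s)^T) 0 1%:M.
have <- : \det (bordered s *m F) = \det (bordered s).
  by rewrite det_mulmx det_ublock !det1 !mulr1.
apply: (congr1 (fun M : 'M[k]_(g + sdim s) => \det M));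
  rewrite /bordered /F mulmx_block /= /retouch_form.
by mx01_simpl; rewrite addrC mulmxA.
Qed.

Lemma det_bordered w : \det (bordered (strip_of w)) = (-1) ^+ g.
Proof.
elim: w => [|[x|y] w IHw].
- rewrite -(det_swap (mulmx1 (1%:M : 'M[k]_g))) mulmx1 subrr.
  by rewrite /bordered /= trmx1.
- rewrite -[strip_of _]/(prepend 0 (prepend (- up_form x) (strip_of w))).
  by rewrite !det_bordered_prepend IHw mulrA -expr2 sqrr_sign mul1r.
by rewrite -[strip_of _]/(retouch (low_form y) (strip_of w)) det_bordered_retouch.
Qed.

(** The bordered matrix sends the columns (-Y, X) to the first basis vectors. *)
Lemma det_strip w Z Y X : @solution k g (strip_of w) Z Y X ->
  \det (sform (strip_of w)) = \det Y.
Proof.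
case=> SX _ lX.
pose F : 'M[k]_(g + sdim (strip_of w)) := block_mx (- Y) 0 X 1%:M.
have : bordered (strip_of w) *m F = block_mx 1%:M (slast (strip_of w))^T 0
  (sform (strip_of w)).
  rewrite mulmx_block lX SX !mulmxN addNr.
  by mx01_simpl.
move/(congr1 determinant); rewrite det_mulmx det_bordered det_lblock det_ublock !det1.
by rewrite mulr1 mul1r -scaleN1r detZ mulrA -expr2 sqrr_sign mul1r => ->.
Qed.

Lemma sdim_strip (w : word) : sdim (strip_of w) = ((odd_letters w).*2.+1 * g)%N.
Proof.
elim: w => [|[x|y] w IHw] /=; rewrite ?mul1n //.
by rewrite IHw /odd_letters /= add1n doubleS !mulSn !addnA.
Qed.

Hypothesis k2 : 2%N \notin [pchar k].

Lemma modI2_strip_class w Z Y X : @solution k g (strip_of w) Z Y X -> Y \in unitmx ->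
  modI2 (strip_class w) = modI2 (rank1 (\det Y)) + (sdim (strip_of w))%:R - 1.
Proof.
move=> sol uY; have [sT _] := strip_of_wf w; rewrite /strip_class modI2_disc //.
  by rewrite (det_strip sol).
by rewrite unitmxE (det_strip sol) -unitmxE.
Qed.

(** The word y n with y = 1 has Y = (-1)^m 1, where m is the number of letters
    of n in the stabilizer of L, while its form has 2 m + 1 blocks.  By
    [strip_class_kerr] the class of n is the difference with that of the one
    letter word y, namely <(-1)^(m g)> + 2 m g - 1, which is 0 modulo 4 = 0
    for either parity of m g. *)
Lemma kernel_class (n : word) : eval_mx n = 1%:M -> modI2 (strip_class n) = 0.
Proof.
move=> n1.
have sym1 : (1%:M : 'M[k]_g)^T == 1%:M by rewrite trmx1.
(* the letter of the identity map, which makes the defect Y invertible *)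
pose y : stabLd k g := Elow (exist (fun A => is_true (A^T == A)) 1%:M sym1).
have low_y : low_form y = 1%:M by apply: low_form_Elow.
have E (v : word) : eval_mx v = 1%:M ->
    modI2 (strip_class (inr y :: v)) =
    modI2 (rank1 ((-1) ^+ (odd_letters v * g))) + (sdim (strip_of v))%:R - 1.
  move=> v1; have [X] := strip_solution (inr y :: v).
  rewrite eval_mx_inr low_y v1 mulmx1 block_mxKdl => sol.
  rewrite (modI2_strip_class sol) ?detZ ?det1 ?mulr1 ?exprM //.
  by rewrite unitmxZ ?unitmx1 // unitrX ?unitrN1.
have := E n n1; rewrite -cat1s strip_class_kerr // modI2D E ?eval_mx_nil //.
rewrite mul0n expr0 rank1_1 modI2_1 /= => {}E.
have {}E : modI2 (strip_class n) = modI2 (rank1 ((-1) ^+ (odd_letters n * g))) +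
   ((odd_letters n * g).*2)%:R - 1.
  rewrite sdim_strip mulSn natrD -doubleMl in E; apply: (addrI (1 + g%:R - 1)).
  rewrite E; ring.
rewrite E; set m := (odd_letters n * g)%N.
have h4 j : (j.*2.*2)%:R = 0 :> witt_I2 k.
  by rewrite -!mul2n mulnA natrM witt_I2_4 mul0r.
rewrite -signr_odd -{2}(odd_double_half m) doubleD natrD h4 addr0.
case: (odd m); rewrite /= ?rank1_1 ?modI2_1 ?addr0 ?subrr //.
rewrite expr1 rank1N1 modI2N modI2_1 addrC addrA -opprD; exact: addNr.
Qed.

End Kernel.

(** * Generation of the linear group *)

Section LinearGroup.
Variables (k : fieldType) (n : nat) (G : 'M[k]_n -> Prop).
Hypothesis GM : forall A B, G A -> G B -> G (A *m B).
Hypothesis GV : forall A, A \in unitmx -> G A -> G (invmx A).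
Hypothesis Gqp : forall q p : 'M[k]_n, q^T = q -> p^T = p ->
  1%:M + q *m p \in unitmx -> G (1%:M + q *m p).

Let bas (j : 'I_n) : 'cV[k]_n := delta_mx j 0.
Let cobas (j : 'I_n) : 'rV[k]_n := delta_mx 0 j.
Let elt (j : 'I_n) (w : 'cV[k]_n) : 'M[k]_n := 1%:M + w *m cobas j.

Lemma cobas_mul j (w : 'cV[k]_n) : cobas j *m w = (w j 0)%:M.
Proof. by rewrite /cobas -rowE [LHS]mx11_scalar mxE. Qed.

Lemma elt_unit j (w : 'cV_n) : 1 + w j 0 != 0 -> elt j w \in unitmx.
Proof.
move=> wj; have : elt j w *m (1%:M - (1 + w j 0)^-1 *: (w *m cobas j)) = 1%:M.
  rewrite /elt; set M := w *m cobas j.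
  have MM : M *m M = w j 0 *: M.
    by rewrite /M mulmxA -[w *m _ *m w]mulmxA cobas_mul mul_mx_scalar -scalemxAl.
  rewrite mulmxBr mulmx1 -scalemxAr mulmxDl mul1mx MM.
  by rewrite -[X in X + w j 0 *: M]scale1r -scalerDl scalerA mulVf // scale1r addrK.
by case/mulmx1_unit.
Qed.

(** The rank one matrix w e_j^T factors as q p with p = e_j e_j^T and q a
    symmetric matrix whose column j is w. *)
Lemma elt_G j (w : 'cV_n) : 1 + w j 0 != 0 -> G (elt j w).
Proof.
move=> wj; pose e := bas j; pose f := cobas j.
have eT : e^T = f by rewrite /e /f trmx_delta.
have fT : f^T = e by rewrite /e /f trmx_delta.
pose q : 'M[k]_n := w *m f + e *m w^T - w j 0 *: (e *m f).
have qT : q^T = q.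
  by rewrite /q linearB linearD linearZ /= !trmx_mul trmxK fT eT [e *m _ + _]addrC.
have pT : (e *m f)^T = e *m f by rewrite trmx_mul fT eT.
have fe : f *m e = 1%:M by rewrite cobas_mul mxE !eqxx.
have wTe : w^T *m e = (w j 0)%:M by apply: trmx_inj;
  rewrite trmx_mul trmxK eT cobas_mul tr_scalar_mx.
have qp : q *m (e *m f) = w *m f.
  rewrite /q mulmxBl mulmxDl -!mulmxA (mulmxA f) fe mul1mx (mulmxA w^T) wTe.
  by rewrite mul_scalar_mx -scalemxAr -scalemxAl -mulmxA (mulmxA f) fe mul1mx addrK.
have := Gqp qT pT; rewrite qp; apply; exact: elt_unit.
Qed.

Lemma elt_bas j (w : 'cV_n) i : i != j -> elt j w *m bas i = bas i.
Proof.
move=> ij; rewrite /elt mulmxDl mul1mx -mulmxA cobas_mul mxE eq_sym (negPf ij) /=.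
by rewrite raddf0 mulmx0 addr0.
Qed.

Lemma elt_bas_same j (w : 'cV_n) : elt j w *m bas j = bas j + w.
Proof. by rewrite /elt mulmxDl mul1mx -mulmxA cobas_mul mxE !eqxx mulmx1. Qed.

Let moved (A : 'M[k]_n) : {set 'I_n} := [set j | col j A != bas j].

(** Induction on the number of columns that differ from those of the identity.
    Such a column j can be turned into the basis vector by a matrix [elt],
    provided that its entry j is nonzero; if that entry vanishes, invertibility
    gives an i such that column i is moved and column j has a nonzero entry in
    row i, and adding row i to row j repairs this without moving more columns. *)
Lemma GL_generated A : A \in unitmx -> G A.
Proof.
move: {2}_.+1 (ltnSn #|moved A|) => m; elim: m A => // m IHm A mA uA.
have [A0|[j]] := set_0Vmem (moved A).
  have -> : A = 1%:M + (0 : 'M_n) *m (0 : 'M_n).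
    rewrite mulmx0 addr0; apply/matrixP => i j.
    have : j \notin moved A by rewrite A0 inE.
    rewrite inE negbK => /eqP/(congr1 (fun v : 'cV_n => v i 0)).
    by rewrite !mxE andbT.
  by apply: Gqp; rewrite ?trmx0 // mulmx0 addr0 unitmx1.
move=> jA.
have reduce (B : 'M[k]_n) : B \in unitmx -> moved B \subset moved A -> B j j != 0 ->
  G B.
  move=> uB BA Bj; pose C := elt j (col j B - bas j).
  have cj : 1 + (col j B - bas j) j 0 != 0 by rewrite !mxE !eqxx addrCA subrr addr0.
  have uC := elt_unit cj.
  have -> : B = C *m (invmx C *m B) by rewrite mulKVmx.
  apply: GM; first exact: elt_G.
  apply: IHm; last by rewrite unitmx_mul unitmx_inv uC.
  rewrite -ltnS; apply: leq_trans mA; rewrite ltnS; apply: proper_card.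
  have hj : col j (invmx C *m B) = bas j.
    rewrite colE -mulmxA -colE.
    have -> : col j B = C *m bas j by rewrite elt_bas_same addrCA subrr addr0.
    by rewrite mulKmx.
  apply/properP; split; last by exists j; rewrite // inE hj eqxx.
  apply: fintype.subset_trans _ BA; apply/fintype.subsetP => i; rewrite !inE; apply:
    contra => /eqP Bi.
  have [->|ij] := eqVneq i j; first by rewrite hj.
  by rewrite colE -mulmxA -colE Bi -{1}(elt_bas (col j B - bas j) ij) mulKmx.
have [Aj|Aj] := eqVneq (A j j) 0; last exact: reduce.
have [i iA Ai] : exists2 i, i \in moved A & A i j != 0.
  apply: contrapT => h; move: jA; rewrite inE => /negP[]; apply/eqP.
  have Av : A *m col j A = col j A.
    apply/matrixP => l o; rewrite ord1 [RHS]mxE -[in RHS](mul1mx A) !mxE.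
    apply: eq_bigr => i _; rewrite !mxE.
    have [->|Ai] := eqVneq (A i j) 0; first by rewrite !mulr0.
    have /negP : i \notin moved A by apply/negP => iA; apply: h; exists i.
    rewrite inE => /negP; rewrite negbK => /eqP/(congr1 (fun v : 'cV_n => v l 0)).
    by rewrite !mxE andbT => ->.
  by apply: (can_inj (mulKmx uA)); rewrite Av colE.
have ij : i != j by apply: contraNneq Ai => ->; rewrite Aj.
pose T := elt i (bas j).
have ci : 1 + bas j i 0 != 0 by rewrite mxE (negPf ij) addr0 oner_neq0.
have uT := elt_unit ci.
have -> : A = invmx T *m (T *m A) by rewrite mulKmx.
apply: GM; first by apply: GV => //; apply: elt_G.
apply: reduce; first by rewrite unitmx_mul uT.
- apply/fintype.subsetP => l; rewrite !inE; apply: contra => /eqP lA.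
  have li : l != i by apply: contraTneq iA => <-; rewrite inE lA eqxx.
  by rewrite colE -mulmxA -colE lA elt_bas.
rewrite /T /elt mulmxDl mul1mx -mulmxA -rowE.
by rewrite !mxE big_ord1 !mxE Aj add0r !eqxx mul1r.
Qed.
End LinearGroup.

(** * Generation of the symplectic group *)

Section Generation.
Variables (k : fieldType) (g : nat).

Definition reachable (A : 'M[k]_(g + g)) : Prop :=
  exists w : SLSLd k g, val (Eval w) = A.

Lemma reachableM A B : reachable A -> reachable B -> reachable (A *m B).
Proof. by case=> u <- [v <-]; exists (u * v)%g; rewrite gmulfM. Qed.

Lemma reachableV A : reachable A -> reachable (invmx A).
Proof. by case=> u <-; exists (u^-1)%g; rewrite gmulfV. Qed.

Lemma reachable_up (q : 'M[k]_g) : q^T = q -> reachable (Eup_mx q).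
Proof.
move=> /eqP qT; pose s : symmx k g := exist (fun A => is_true (A^T == A)) q qT.
exists (\pi_(SLSLd k g) [:: inl (Eup s)]).
by rewrite -/(eval_mx _) eval_mx_inl eval_mx_nil mulmx1 up_form_Eup.
Qed.

Lemma reachable_low (q : 'M[k]_g) : q^T = q -> reachable (Elow_mx q).
Proof.
move=> /eqP qT; pose s : symmx k g := exist (fun A => is_true (A^T == A)) q qT.
exists (\pi_(SLSLd k g) [:: inr (Elow s)]).
by rewrite -/(eval_mx _) eval_mx_inr eval_mx_nil mulmx1 low_form_Elow.
Qed.

Lemma Elow_mxD (q r : 'M[k]_g) : Elow_mx q *m Elow_mx r = Elow_mx (q + r).
Proof. by rewrite /Elow_mx mulmx_block; mx01_simpl. Qed.

Lemma Eup_mxD (q r : 'M[k]_g) : Eup_mx q *m Eup_mx r = Eup_mx (q + r).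
Proof. by rewrite /Eup_mx mulmx_block; mx01_simpl; rewrite addrC. Qed.

Lemma Elow_mx0 : Elow_mx (0 : 'M[k]_g) = 1%:M.
Proof. by rewrite [RHS]scalar_mx_block. Qed.

Lemma Eup_mx0 : Eup_mx (0 : 'M[k]_g) = 1%:M.
Proof. by rewrite [RHS]scalar_mx_block. Qed.

Definition levi (A : 'M[k]_g) : 'M[k]_(g + g) := block_mx A 0 0 (invmx A)^T.

(** Block elimination; invariance of the symplectic form makes both elimination
    matrices symmetric and determines the last block. *)
Lemma symplectic_factor (A B C D : 'M[k]_g) (M := block_mx A B C D) :
  M^T *m Jmx k g *m M = Jmx k g -> A \in unitmx ->
  exists q p : 'M[k]_g, [/\ q^T = q, p^T = p & M = Elow_mx q *m levi A *m Eup_mx p].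
Proof.
move=> MJ uA; have uAT : A^T \in unitmx by rewrite unitmx_tr.
move: MJ; rewrite /M tr_block_mx /Jmx !mulmx_block.
rewrite !(mulmxN, mulNmx); mx01_simpl; rewrite !mulNmx.
case/eq_block_mx => E1 E2 E3 E4.
have AC : A^T *m C = C^T *m A by apply/esym/subr0_eq.
have qT : (C *m invmx A)^T = C *m invmx A.
  rewrite trmx_mul trmx_inv -[C^T](mulmxK uA) -AC !mulmxA mulVmx // mul1mx //.
have DE : D = C *m invmx A *m B + (invmx A)^T.
  rewrite -qT trmx_mul -mulmxA -{2}[(invmx A)^T]mulmx1 -mulmxDr trmx_inv.
  move/eqP: E2; rewrite subr_eq addrC -subr_eq opprK => /eqP ->.
  by rewrite mulKmx.
have pT : (invmx A *m B)^T = invmx A *m B.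
  apply/esym; move/subr0_eq: E4; rewrite DE [(_ + _)^T]linearD /= trmxK.
  rewrite trmx_mul qT mulmxDl mulmxDr trmx_mul !mulmxA.
  by move/addrI.
exists (C *m invmx A), (invmx A *m B); split=> //.
rewrite /Elow_mx /levi /Eup_mx !mulmx_block; mx01_simpl.
by rewrite mulKVmx // mulmxKV // mulmxA -DE.
Qed.

Lemma symplectic_reachable (A B C D : 'M[k]_g) (M := block_mx A B C D) :
  M^T *m Jmx k g *m M = Jmx k g -> A \in unitmx -> reachable M <-> reachable (levi A).
Proof.
move=> MJ uA; have [q [p [qT pT E]]] := symplectic_factor MJ uA.
have qNT : (- q)^T = - q by rewrite linearN /= qT.
have pNT : (- p)^T = - p by rewrite linearN /= pT.
split=> h.
  have -> : levi A = Elow_mx (- q) *m M *m Eup_mx (- p).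
    rewrite /M E !mulmxA Elow_mxD addNr Elow_mx0 mul1mx -mulmxA Eup_mxD addrN Eup_mx0.
    by rewrite mulmx1.
  by do 2?apply: reachableM; [apply: reachable_low | | apply: reachable_up].
by rewrite /M E; do 2?apply: reachableM; [apply: reachable_low | | apply: reachable_up].
Qed.

(** The product of the two elementary matrices of q and p has upper left block
    1 + q p, so [symplectic_factor] reaches the corresponding block diagonal
    matrix, and such matrices 1 + q p generate the linear group. *)
Lemma levi_reachable A : A \in unitmx -> reachable (levi A).
Proof.
have leviM B C : B \in unitmx -> C \in unitmx -> levi B *m levi C = levi (B *m C).
  move=> uB uC; rewrite /levi mulmx_block; mx01_simpl.
  have uBC : B *m C \in unitmx by rewrite unitmx_mul uB.
  rewrite -trmx_mul -[invmx C *m invmx B](mulmxK uBC) mulmxA mulmxKV //.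
  by rewrite mulVmx // mul1mx.
pose G B := B \in unitmx /\ reachable (levi B).
suff: forall B, B \in unitmx -> G B by move=> h /h[].
apply: GL_generated => [B C [uB rB] [uC rC]|B uB [_ rB]|q p qT pT u].
- split; first by rewrite unitmx_mul uB.
  by rewrite -leviM //; apply: reachableM.
- split; first by rewrite unitmx_inv.
  have -> : levi (invmx B) = invmx (levi B).
    have E : levi (invmx B) *m levi B = 1%:M.
      rewrite leviM ?unitmx_inv // mulVmx // /levi invmx1 trmx1.
      by rewrite -scalar_mx_block.
    have [_ uL] := mulmx1_unit E.
    by rewrite -[LHS]mulmx1 -(mulmxV uL) mulmxA E mul1mx.
  exact: reachableV.
split=> //.
have r : reachable (Eup_mx q *m Elow_mx p).
  by apply: reachableM; [apply: reachable_up | apply: reachable_low].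
have J : (Eup_mx q *m Elow_mx p)^T *m Jmx k g *m (Eup_mx q *m Elow_mx p) = Jmx k g.
  by case: r => w <-; apply: Sp_mulJ.
move: J r; rewrite /Eup_mx /Elow_mx mulmx_block; mx01_simpl => J r.
by apply/(symplectic_reachable J).
Qed.

(** Let V be the image under C of the kernel of A.  Since A^T C is symmetric, V
    is orthogonal to the image of A, and C is injective on the kernel of A.
    Take for q a form that is nondegenerate on V, namely W W^T for a left
    inverse W^T of a basis of V: then A x + q C x = 0, paired with V, gives
    q C x = 0, hence A x = 0 and x = 0. *)
Lemma symplectic_shear (A C : 'M[k]_g) :
  A^T *m C = C^T *m A -> row_free (row_mx A^T C^T) ->
  exists q : 'M[k]_g, q^T = q /\ A + q *m C \in unitmx.
Proof.
move=> AC fr; pose N := row_base (kermx A^T).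
have NA : N *m A^T = 0 by apply/sub_kermxP; rewrite eq_row_base.
have AN : A *m N^T = 0 by apply: trmx_inj; rewrite trmx_mul trmxK NA trmx0.
have NC : row_free (N *m C^T).
  rewrite /row_free; have := mxrankMfree N fr.
  by rewrite mul_mx_row NA rank_row_0mx => ->; apply: row_base_free.
have /row_freeP[W NCW] := NC.
have WCN : W^T *m (C *m N^T) = 1%:M.
  by apply: trmx_inj; rewrite !trmx_mul !trmxK NCW trmx1.
exists (W *m W^T); split; first by rewrite trmx_mul trmxK.
rewrite -unitmx_tr -row_free_unit; apply: inj_row_free => y.
rewrite linearD /= !trmx_mul trmxK mulmxDr => y0.
have yA : y *m A^T *m (C *m N^T) = 0.
  by rewrite -!mulmxA (mulmxA A^T) AC -mulmxA AN !mulmx0.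
have yW : y *m (C^T *m W) = 0.
  move: (congr1 (mulmx^~ (C *m N^T)) y0); rewrite /= mulmxDl yA add0r mul0mx.
  by rewrite -!mulmxA WCN mulmx1.
have : y *m A^T = 0.
  by move: y0; rewrite [C^T *m _]mulmxA [y *m (_ *m W^T)]mulmxA yW mul0mx addr0.
move/sub_kermxP; rewrite -(eq_row_base (kermx A^T)) => /submxP[u yu].
by move: yW; rewrite yu -/N -mulmxA (mulmxA N) NCW mulmx1 => ->; rewrite mul0mx.
Qed.

Lemma Eval_surjective (x : Sp k g) : exists w, Eval w = x.
Proof.
suff [w wx] : reachable (val x) by exists w; apply: val_inj.
have xJ := Sp_mulJ x; have ux := Sp_unit x.
move: (val x) xJ ux => M; rewrite -[M]submxK.
move: (ulsubmx M) (ursubmx M) (dlsubmx M) (drsubmx M) => A B C D {M x} MJ uM.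
have fr : row_free (row_mx A^T C^T).
  apply/row_freeP; exists (invmx (block_mx A B C D)^T *m col_mx 1%:M 0).
  have -> : row_mx A^T C^T = row_mx 1%:M 0 *m (block_mx A B C D)^T.
    by rewrite tr_block_mx mul_row_block; mx01_simpl.
  by rewrite -mulmxA mulKVmx ?unitmx_tr // mul_row_col; mx01_simpl.
have AC : A^T *m C = C^T *m A.
  move: MJ; rewrite tr_block_mx /Jmx !mulmx_block !(mulmxN, mulNmx); mx01_simpl;
    rewrite !mulNmx.
  by case/eq_block_mx => /subr0_eq.
have [q [qT uq]] := symplectic_shear AC fr.
have qNT : (- q)^T = - q by rewrite linearN /= qT.
have -> : block_mx A B C D = Eup_mx (- q) *m (Eup_mx q *m block_mx A B C D).
  by rewrite mulmxA Eup_mxD addNr Eup_mx0 mul1mx.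
apply: reachableM; first exact: reachable_up.
have [w wq] := reachable_up qT.
have J : (Eup_mx q *m block_mx A B C D)^T *m Jmx k g *m (Eup_mx q *m block_mx A B C D)
  = Jmx k g.
  by rewrite trmx_mul !mulmxA -(mulmxA _ _ (Jmx k g)) -(mulmxA _ _ (Eup_mx q)) -wq
    Sp_mulJ.
have E : Eup_mx q *m block_mx A B C D = block_mx (A + q *m C) (B + q *m D) C D.
  by rewrite /Eup_mx mulmx_block; mx01_simpl.
rewrite E in J *.
exact/(symplectic_reachable J uq)/levi_reachable.
Qed.
End Generation.

(** * Independence of the lift, and triviality of homomorphisms *)

Section Lifts.
Variables (k : fieldType) (g : nat).
Implicit Types a b m n w : SLSLd k g.

Lemma EvalM a b : Eval (a * b)%g = (Eval a * Eval b)%g.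
Proof. exact: gmulfM. Qed.

Lemma EvalV a : Eval (a^-1)%g = ((Eval a)^-1)%g.
Proof. exact: gmulfV. Qed.

Lemma f00_kerl n w : Eval n = 1%g -> f00 (n * w)%g = f00 n + f00 w.
Proof.
elim/quotW: n => n; elim/quotW: w => w n1; rewrite -pi_cat !f00_pi.
by apply: strip_class_kerl; rewrite /eval_mx n1.
Qed.

Lemma f00_kerr n w : Eval n = 1%g -> f00 (w * n)%g = f00 w + f00 n.
Proof.
elim/quotW: n => n; elim/quotW: w => w n1; rewrite -pi_cat !f00_pi.
by apply: strip_class_kerr; rewrite /eval_mx n1.
Qed.

Lemma f00_conj n w : Eval n = 1%g -> f00 (w * n * w^-1)%g = f00 n.
Proof.
move=> n1; apply: (addIr (f00 w)).
rewrite -f00_kerl; last by rewrite !EvalM n1 mulg1 EvalV mulgV.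
by rewrite -mulgA mulVg mulg1 f00_kerr // addrC.
Qed.

(** Two lifts differ by relations, which can be conjugated to the front. *)
Lemma f00_cocycle_lift a a' b b' : Eval a' = Eval a -> Eval b' = Eval b ->
  f00 (a' * b')%g - f00 a' - f00 b' = f00 (a * b)%g - f00 a - f00 b.
Proof.
move=> aa bb; pose m := (a^-1 * a')%g; pose n := (b' * b^-1)%g.
have m1 : Eval m = 1%g by rewrite EvalM EvalV aa mulVg.
have n1 : Eval n = 1%g by rewrite EvalM EvalV bb mulgV.
have -> : a' = (a * m)%g by rewrite mulgA mulgV mul1g.
have -> : b' = (n * b)%g by rewrite -mulgA mulVg mulg1.
clearbody m n.
have mn1 : Eval (m * n)%g = 1%g by rewrite EvalM m1 n1 mulg1.
have -> : (a * m * (n * b))%g = (a * (m * n) * a^-1 * (a * b))%g.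
  by rewrite !mulgA mulgVK.
rewrite [f00 (_ * (a * b))%g]f00_kerl; last by rewrite !EvalM m1 n1 !mulg1 EvalV mulgV.
rewrite f00_conj // (f00_kerl n m1) (f00_kerl b n1) (f00_kerr a m1); ring.
Qed.

Lemma mu_lift a b : mu (Eval a) (Eval b) = f00 (a * b)%g - f00 a - f00 b.
Proof.
apply: xget_unique; first by exists a, b.
by move=> c [a' [b' [aa bb ->]]]; apply: f00_cocycle_lift.
Qed.

Lemma modI2_f00_kernel (k2 : 2%N \notin [pchar k]) n : Eval n = 1%g ->
  modI2 (f00 n) = 0.
Proof.
elim/quotW: n => n n1; rewrite f00_pi; apply: kernel_class => //.
by rewrite /eval_mx n1.
Qed.

Lemma modI2_f00_lift (k2 : 2%N \notin [pchar k]) a b :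
  Eval a = Eval b -> modI2 (f00 a) = modI2 (f00 b).
Proof.
move=> ab; have n1 : Eval (a * b^-1)%g = 1%g by rewrite EvalM EvalV ab mulgV.
have -> : a = (a * b^-1 * b)%g by rewrite mulgVK.
by rewrite f00_kerl // modI2D modI2_f00_kernel // add0r.
Qed.

Lemma dilation_proof (c : k) : c != 0 -> forall u v : 'cV[k]_(g + g),
  omega (block_mx c%:M 0 0 (c^-1)%:M *m u) (block_mx c%:M 0 0 (c^-1)%:M *m v) = omega
    u v.
Proof.
move=> c0; apply/SpP; rewrite tr_block_mx !tr_scalar_mx /Jmx !mulmx_block; mx01_simpl.
by rewrite !(mulmxN, mulNmx); mx01_simpl; rewrite -!scalar_mxM mulVf ?divff.
Qed.

(** Conjugation by d = diag(2, 1/2) replaces q by 4 q or q/4, so chi(q) = 4 chi(q),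
    and this is 0. *)
Lemma Sp_hom_trivial (k2 : 2%N \notin [pchar k]) (V : zmodType) (chi : Sp k g -> V) :
  (forall x y, chi (x * y)%g = chi x + chi y) -> (forall v : V, v *+ 4 = 0) ->
  forall x, chi x = 0.
Proof.
move=> chiM V4.
have chi1 : chi 1%g = 0 by apply: (addIr (chi 1%g)); rewrite -chiM mulg1 add0r.
have two0 : (2%:R : k) != 0 by apply: contra k2 => two; rewrite inE.
pose d := mkSp (dilation_proof two0).
(* the two forms of conjugation by d that occur on the two stabilizers *)
have conj4 (x : Sp k g) : (d * x = x * x * (x * x) * d)%g -> chi x = 0.
  move=> E; have := chiM d x; rewrite E !chiM addrC => /addrI E4.
  by rewrite -E4 -[RHS](V4 (chi x)) -!mulr2n -mulrnA.
have conj4V (x : Sp k g) : (d * (x * x * (x * x)) = x * d)%g -> chi x = 0.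
  move=> E; have := chiM x d; rewrite -E !chiM addrC => /addIr <-.
  by rewrite -[RHS](V4 (chi x)) -!mulr2n -mulrnA.
have quad (q : 'M[k]_g) : q + q + (q + q) = 2%:R *: (2%:R *: q).
  by rewrite !scaler_nat !mulr2n.
have chi_up (x : stabL k g) : chi (val x) = 0.
  apply: conj4; apply: val_inj; rewrite !Sp_valM.
  have [-> _] := stabL_mx x; rewrite !Eup_mxD /= /Eup_mx quad !mulmx_block; mx01_simpl.
  by rewrite mul_mx_scalar mul_scalar_mx scalerK ?unitfE.
have chi_low (x : stabLd k g) : chi (val x) = 0.
  apply: conj4V; apply: val_inj; rewrite !Sp_valM.
  have [-> _] := stabLd_mx x; rewrite !Elow_mxD /= /Elow_mx quad !mulmx_block;
    mx01_simpl.
  by rewrite mul_mx_scalar mul_scalar_mx scalerK ?unitfE.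
move=> x; have [w <-] := Eval_surjective x; elim/quotW: w => w.
rewrite [Eval _](pi_fpeval _ _ w) /fpword_eval.
elim/big_rec: _ => [//|[y|y] z _ z0]; rewrite chiM z0 addr0;
  [exact: chi_up | exact: chi_low].
Qed.

End Lifts.

Unset Implicit Arguments.

Theorem theorem5p8 (k : fieldType) (hk : 2%N \notin [pchar k])
    (g : nat) (hg : (1 <= g)%N) :
  exists Phi : Sp k g -> witt_I2 k,
    (forall (x : Sp k g) (w : SLSLd k g), Eval w = x -> Phi x = modI2 (f00 w)) /\
    (forall x y : Sp k g, Phi (x * y)%g - Phi x - Phi y = modI2 (mu x y)) /\
    (forall Psi : Sp k g -> witt_I2 k,
      (forall x y : Sp k g, Psi (x * y)%g - Psi x - Psi y = modI2 (mu x y)) ->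
      forall x : Sp k g, Psi x = Phi x).
Proof.
have [lift liftK] := choice (@Eval_surjective k g).
pose Phi x := modI2 (f00 (lift x)).
have PhiE x w : Eval w = x -> Phi x = modI2 (f00 w).
  by move=> wx; apply: modI2_f00_lift; rewrite ?liftK.
have PhiM x y : Phi (x * y)%g - Phi x - Phi y = modI2 (mu x y).
  rewrite (PhiE _ (lift x * lift y)%g) ?EvalM ?liftK //.
  by have := mu_lift (lift x) (lift y); rewrite !liftK => ->; rewrite !modI2D !modI2N.
exists Phi; split; [exact: PhiE | split; first exact: PhiM].
move=> Psi PsiM x; apply/eqP; rewrite -subr_eq0; apply/eqP; move: x.
apply: (Sp_hom_trivial hk) => [x y|v]; last exact: witt_I2_mul4.
have /eqP := PsiM x y; rewrite -PhiM !subr_eq => /eqP ->; ring.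
Qed.
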